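(* Let $k\geq2$ be an integer and let $\mathcal{S}$ be a ring with $\mathbb{Q}\subseteq\mathcal{S}\subseteq\mathbb{A}$, where $\mathbb{A}$ is the set of real algebraic numbers. The decision problem ''Given a $k$-regular sequence $(f(n))_{n\geq0}$ over $\mathcal{S}$, does $f(n)$ have at least polynomial growth, i.e., does there exist $\sigma>0$ such that $f(n)\notin O(n^\sigma)$?'' is recursively unsolvable.
   Context: For $n\in\mathbb{N}_0$ let $(n)_k=n_{s-1}\cdots n_0$ be the standard base-$k$ representation of $n$ (no leading zeros; $(0)_k$ empty). A sequence $(f(n))_{n\geq0}$ over $\mathcal{S}$ is $k$-regular if there exist $r\geq0$, a $1\times r$ row vector $v$, an $r\times1$ column vector $w$ and $r\times r$ matrices $M_0,\dots,M_{k-1}$ with entries in $\mathcal{S}$ such that $f(n)=vM_{n_0}\cdots M_{n_{s-1}}w$ for all $n$. The input is such a linear representation; a real algebraic number is given by its minimal polynomial together with a rational interval containing it and none of its conjugates. $f(n)\in O(g(n))$ means there exist $n_0$, $c>0$ with $|f(n)|\leq c\,g(n)$ for all $n\geq n_0$. *)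

(* Defs.v *)
From HB Require Import structures.
From mathcomp Require Import all_boot all_order all_algebra.
From mathcomp Require Import reals exp.
Set Implicit Arguments. Unset Strict Implicit. Unset Printing Implicit Defensive.
Import Order.TTheory GRing.Theory Num.Theory.
Local Open Scope ring_scope.

(* Model of computation: counter (Minsky) machines over nat.            *)
Inductive instr : Type :=
| INC of nat
| DECJZ of nat & nat.

Definition mstate : Type := (nat * seq nat)%type.

Definition step (prog : seq instr) (st : mstate) : option mstate :=
  let: (pc, regs) := st in
  match nth (INC 0) prog pc with
  | INC r => Some (pc.+1, set_nth 0%N regs r (nth 0%N regs r).+1)
  | DECJZ r j =>
      if nth 0%N regs r == 0%N then Some (j, regs)
      else Some (pc.+1, set_nth 0%N regs r (nth 0%N regs r).-1)
  end.

Fixpoint run (prog : seq instr) (fuel : nat) (st : mstate) : option mstate :=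
  if (size prog <= st.1)%N then Some st else
  match fuel with
  | 0 => None
  | f.+1 => match step prog st with Some st' => run prog f st' | None => None end
  end.

Definition halts_with (prog : seq instr) (input output : nat) : Prop :=
  exists fuel st, run prog fuel (0%N, [:: input]) = Some st /\ nth 0%N st.2 0 = output.

(* Base-k digits, least significant first: (n)_k = n_{s-1} ... n_0,     *)
(* digits k n = [:: n_0; n_1; ...; n_{s-1}], digits k 0 = [::].         *)
Fixpoint digits_fuel (k fuel n : nat) : seq nat :=
  match fuel with
  | 0 => [::]
  | f.+1 => if n == 0%N then [::] else (n %% k)%N :: digits_fuel k f (n %/ k)%N
  end.

Definition digits (k n : nat) : seq nat := digits_fuel k n n.

Definition algebraic (R : realType) (x : R) : Prop :=
  exists p : {poly rat}, p != 0 /\ root (map_poly ratr p) x.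

(* description: (coefficients of the minimal polynomial, low degree first,
   left end, right end) of an isolating rational interval *)
Definition algdesc : Type := (seq rat * rat * rat)%type.

Definition denotes (R : realType) (d : algdesc) (x : R) : Prop :=
  let: (ps, a, b) := d in
  let p : {poly rat} := Poly ps in
  [/\ p \is monic, irreducible_poly p,
      root (map_poly ratr p) x, ratr a <= x <= ratr b &
      forall y : R, root (map_poly ratr p) y -> ratr a <= y <= ratr b -> y = x].

(* An input: (r, v, w, Ms) with v, w lists of r entries, Ms a list of k
   matrices, each a row-major list of r*r entries. Inputs are coded as
   natural numbers via the canonical countType encoding [pickle]. *)
Definition lrep_code : Type :=
  (nat * seq algdesc * seq algdesc * seq (seq algdesc))%type.

Definition d0 : algdesc := ([::], 0, 0).

Definition represents (R : realType) (k : nat) (S : {pred R}) (c : nat)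
    (f : nat -> R) : Prop :=
  exists (r : nat) (dv dw : seq algdesc) (dM : seq (seq algdesc))
         (v : 'rV[R]_r) (w : 'cV[R]_r) (M : nat -> 'M[R]_r),
  [/\ unpickle c = Some (r, dv, dw, dM) :> option lrep_code,
      size dv = r, size dw = r, size dM = k &
      (forall j, (j < k)%N -> size (nth [::] dM j) = (r * r)%N)] /\
  [/\ (forall i : 'I_r, denotes (nth d0 dv i) (v 0 i) /\ v 0 i \in S),
      (forall i : 'I_r, denotes (nth d0 dw i) (w i 0) /\ w i 0 \in S),
      (forall j, (j < k)%N -> forall i l : 'I_r,
          denotes (nth d0 (nth [::] dM j) (i * r + l)) (M j i l) /\ M j i l \in S) &
      forall n, f n = (v *m foldr (fun d acc => M d *m acc) w (digits k n)) 0 0].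

Definition bigO_pow (R : realType) (f : nat -> R) (sigma : R) : Prop :=
  exists (n0 : nat) (c : R), 0 < c /\
    forall n, (n0 <= n)%N -> `|f n| <= c * powR (n%:R) sigma.

Definition poly_growth (R : realType) (f : nat -> R) : Prop :=
  exists sigma : R, 0 < sigma /\ ~ bigO_pow f sigma.

Definition decides_poly_growth (R : realType) (k : nat) (S : {pred R})
    (prog : seq instr) : Prop :=
  forall c f, represents k S c f ->
    (poly_growth f -> halts_with prog c 1) /\
    (~ poly_growth f -> halts_with prog c 0).

(* Main.v *)
Require Import Defs.
From HB Require Import structures.
From mathcomp Require Import all_boot all_order all_algebra.
From mathcomp Require Import reals exp.
From mathcomp Require Import zify ring lra.
Import Order.TTheory GRing.Theory Num.Theory.
Local Open Scope ring_scope.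

(* Let pen(u) be a nonnegative integer "penalty" of a word u, computed by a product of integer
   matrices.  For kappa and delta small there is a rational series
   g(u) = 1 + kappa delta^|u| (rho^2 - (y_u rho - 1)^2 - pen(u) - (pc_u + 1)^2), rho = 1/y, with
   0 < g(u) <= 1 except when u is accepting (pen(u) = 0, pc_u = -1, y_u = y), where g(u) > 1.
   Reading the base-k digits of n as a sequence of words u_1, ..., u_m (a digit string 0^i 1
   selects the i-th letter, the last letter being a separator), the k-regular sequence
   f(n) = g(u_1) ... g(u_m) is bounded by 1 if no word is accepting and otherwise grows like a
   power of n.
   The letters are the steps of a nondeterministic machine with linear updates and linear checks,
   the penalty being the sum of the squares of all failed checks.  It guesses numbers A, T, U,
   keeping y = 2^A 3^T 5^U, computes from them the code c of a linear representation, simulates a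
   given counter machine D on input c, and accepts if D answers 0.
   Only the two entries rho^2, rho of the first row of the first matrix depend on y, so A, T, U
   can be taken to be the codes of all the other parts of the representation of f itself; then c
   is the code of f, and f has polynomial growth iff D answers 0 on c, so D does not decide
   growth. *)

(** * Linear checks and updates *)

Definition lform := seq (int * nat).
Definition letter := (seq lform * seq (nat * lform))%type.

Definition ev (l : lform) (X : nat -> int) : int :=
  foldr (fun p s => p.1 * X p.2 + s) 0 l.

Definition upd (asg : seq (nat * lform)) (X : nat -> int) (i : nat) : int :=
  foldr (fun p acc => if i == p.1 then ev p.2 X else acc) (X i) asg.

Definition legal (a : letter) (X : nat -> int) : bool :=
  all (fun l => ev l X == 0) a.1.

(** The head of a word is the letter executed last. Digits are listed least significant first, so
    this is the order in which [foldr] consumes them. *)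
Fixpoint sem (X0 : nat -> int) (u : seq letter) : nat -> int :=
  if u is a :: u' then upd a.2 (sem X0 u') else X0.

Fixpoint pen (X0 : nat -> int) (u : seq letter) : int :=
  if u is a :: u' then pen X0 u' + \sum_(l <- a.1) (ev l (sem X0 u')) ^+ 2
  else 0.

Inductive reach (lets : seq letter) (X0 : nat -> int) : (nat -> int) -> Prop :=
| reach0 : reach lets X0 X0
| reachS a X : a \in lets -> legal a X -> reach lets X0 X ->
    reach lets X0 (upd a.2 X).

Lemma pen_ge0 X0 u : 0 <= pen X0 u.
Proof.
elim: u => //= a u IH; apply: addr_ge0 => //.
by apply: sumr_ge0 => l _; apply: sqr_ge0.
Qed.

Lemma sum_sqr_eq0 (X : nat -> int) (ls : seq lform) :
  (\sum_(l <- ls) (ev l X) ^+ 2 == 0) = all (fun l => ev l X == 0) ls.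
Proof.
rewrite psumr_eq0; last by move=> l _; apply: sqr_ge0.
by apply: eq_all => l; rewrite /= sqrf_eq0.
Qed.

(** A sum of squares vanishes only if every square does, so words of penalty 0 are legal runs;
    [reach_pen0] is the converse. *)
Lemma pen0_reach lets X0 u :
  all (mem lets) u -> pen X0 u = 0 -> reach lets X0 (sem X0 u).
Proof.
elim: u => [|a u IH] /=; first by move=> _ _; apply: reach0.
case/andP=> al ul /eqP; rewrite paddr_eq0 ?pen_ge0 //; last first.
  by apply: sumr_ge0 => l _; apply: sqr_ge0.
by rewrite sum_sqr_eq0 => /andP[/eqP p0 la]; apply: reachS => //; apply: IH.
Qed.

Lemma reach_pen0 lets X0 X : reach lets X0 X ->
  exists2 u, all (mem lets) u & pen X0 u = 0 /\ sem X0 u = X.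
Proof.
elim=> [|a {}X al la _ [u ul [p0 sX]]]; first by exists [::].
exists (a :: u); rewrite /= ?al //; rewrite p0 sX add0r; split=> //.
by apply/eqP; rewrite sum_sqr_eq0.
Qed.

(** * The machine computing a code and simulating a counter machine *)

Definition nform := seq (nat * nat).
Definition nev (l : nform) (x : nat -> nat) : nat :=
  foldr (fun p s => p.1 * x p.2 + s)%N 0%N l.
Definition zf (l : nform) : lform := [seq (p.1%:Z, p.2) | p <- l].

Lemma ev_zf l (x : nat -> nat) (X : nat -> int) :
  (forall p, p \in l -> X p.2 = (x p.2)%:Z) -> ev (zf l) X = (nev l x)%:Z.
Proof.
elim: l => //= p l IH H; rewrite IH; last first.
  by move=> q ql; apply: H; rewrite inE ql orbT.
by rewrite H ?mem_head // PoszD PoszM.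
Qed.

Definition stage := (nform * nform * nform)%type.
Definition stage0 : stage := ([::], [::], [::]).

Definition yv (A T U : nat) : nat := (2 ^ A * 3 ^ T * 5 ^ U)%N.
Definition y2v (A T U : nat) : nat := (4 ^ A * 9 ^ T * 25 ^ U)%N.

(** Indexed like the coordinates of the machine. The counter, the ticks and the loop variable [e]
    are filled with 0, since forms restricted to [vars] never read them. *)
Definition env (A T U M S : nat) : nat -> nat :=
  nth 0%N [:: 1; 0; 0; yv A T U; y2v A T U; 2 ^ A; T; U; 0; M; S]%N.

(* the state (e, m, s) at the start of each stage; the stage itself replaces m by m * 2 ^ e *)
Definition nxt (A T U : nat) (v : nat * nat * nat) (st : stage) :=
  let x := env A T U (v.1.2 * 2 ^ v.1.1) v.2 in
  (nev st.1.1 x, nev st.1.2 x, nev st.2 x).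

Definition vals (chain : seq stage) (A T U i : nat) :=
  foldl (nxt A T U) (0, 0, 0)%N (take i chain).

Definition cval (chain : seq stage) (out : nform) (A T U : nat) : nat :=
  let v := vals chain A T U (size chain) in
  nev out (env A T U (v.1.2 * 2 ^ v.1.1) v.2).

Definition vars : seq nat := [:: 0; 3; 4; 5; 6; 7; 9; 10]%N.
Definition okf (l : nform) : bool := all (fun p => p.2 \in vars) l.
Definition okst (st : stage) : bool := [&& okf st.1.1, okf st.1.2 & okf st.2].

(* Coordinates: 0 is the constant 1, 1 the program counter, 3 and 4 hold y and y^2, 5 holds 2^A,
   6 and 7 hold T and U, 8, 9, 10 the loop variables e, m, s, and 11 + r is register r of D.
   Coordinate 2 counts ticks, which may be inserted anywhere, hence is nonnegative: a check such
   as "R_r = tick + 1" expresses that R_r is positive by an equation. *)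
Notation Reg r := (r.+4.+4.+3).

Definition Ltick : letter := ([::], [:: (2%N, [:: (1, 2%N); (1, 0%N)])]).
(** No check guards this letter. Firing it too often makes [e] negative, and then no stage can ever
    be left; once the simulation of [D] has begun, its two coordinates are no longer read. *)
Definition Lloop : letter :=
  ([::], [:: (8%N, [:: (1, 8%N); (-1, 0%N)]); (9%N, [:: (2, 9%N)])]).
Definition LA : letter :=
  ([:: [:: (1, 1%N)]],
   [:: (3%N, [:: (2, 3%N)]); (4%N, [:: (4, 4%N)]); (5%N, [:: (2, 5%N)])]).
Definition LT : letter :=
  ([:: [:: (1, 1%N)]],
   [:: (3%N, [:: (3, 3%N)]); (4%N, [:: (9, 4%N)]); (6%N, [:: (1, 6%N); (1, 0%N)])]).
Definition LU : letter :=
  ([:: [:: (1, 1%N)]],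
   [:: (3%N, [:: (5, 3%N)]); (4%N, [:: (25, 4%N)]); (7%N, [:: (1, 7%N); (1, 0%N)])]).
Definition Lst (i : nat) (st : stage) : letter :=
  ([:: [:: (1, 1%N); (- i%:Z, 0%N)]; [:: (1, 8%N)]],
   [:: (1%N, [:: (i.+1%:Z, 0%N)]); (8%N, zf st.1.1); (9%N, zf st.1.2);
       (10%N, zf st.2)]).
Definition Lout (K : nat) (out : nform) : letter :=
  ([:: [:: (1, 1%N); (- K%:Z, 0%N)]; [:: (1, 8%N)]],
   [:: (1%N, [:: (K.+1%:Z, 0%N)]); (2%N, [::]); (11%N, zf out)]).
Definition Linc (o p r : nat) : letter :=
  ([:: [:: (1, 1%N); (- (o + p)%:Z, 0%N)]],
   [:: (1%N, [:: ((o + p.+1)%:Z, 0%N)]); (Reg r, [:: (1, Reg r); (1, 0%N)])]).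
Definition Ldz (o p r j : nat) : letter :=
  ([:: [:: (1, 1%N); (- (o + p)%:Z, 0%N)]; [:: (1, Reg r)]],
   [:: (1%N, [:: ((o + j)%:Z, 0%N)])]).
Definition Ldn (o p r : nat) : letter :=
  ([:: [:: (1, 1%N); (- (o + p)%:Z, 0%N)];
       [:: (1, Reg r); (-1, 2%N); (-1, 0%N)]],
   [:: (1%N, [:: ((o + p.+1)%:Z, 0%N)]); (Reg r, [:: (1, Reg r); (-1, 0%N)]);
       (2%N, [::])]).
(** [run] stops at every address past the end of the program, and a jump may lead to any of them.
    The nonnegative tick count turns the condition that the counter is at least [o] into an
    equation. *)
Definition Lhalt (o : nat) : letter :=
  ([:: [:: (1, 1%N); (- o%:Z, 0%N); (-1, 2%N)]; [:: (1, Reg 0)]],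
   [:: (1%N, [:: (-1, 0%N)])]).

Definition Dlets (o : nat) (D : seq instr) (p : nat) : seq letter :=
  match nth (INC 0) D p with
  | INC r => [:: Linc o p r]
  | DECJZ r j => [:: Ldz o p r j; Ldn o p r]
  end.

Definition lets (D : seq instr) (chain : seq stage) (out : nform) : seq letter :=
  let K := size chain in
  [:: Ltick; Lloop; LA; LT; LU; Lout K out; Lhalt (K.+1 + size D)] ++
  [seq Lst i (nth stage0 chain i) | i <- iota 0 K] ++
  flatten [seq Dlets K.+1 D p | p <- iota 0 (size D)].

Definition Xinit (i : nat) : int :=
  if i \in [:: 0; 3; 4; 5]%N then 1 else 0.

Lemma run_step D f st st' : (st.1 < size D)%N -> step D st = Some st' ->
  run D f.+1 st = run D f st'.
Proof. by move=> pD e; cbn [run]; rewrite leqNgt pD e. Qed.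

Section Simulation.
Variables (D : seq instr) (chain : seq stage) (out : nform).
Hypotheses (okc : all okst chain) (oko : okf out).
Local Notation K := (size chain).
Local Notation ls := (lets D chain out).

(** * Soundness: an invariant of legal runs *)

Definition guessed (A T U : nat) (X : nat -> int) : Prop :=
  [/\ X 3%N = (yv A T U)%:Z, X 4%N = (y2v A T U)%:Z, X 5%N = (2 ^ A)%:Z,
      X 6%N = T%:Z & X 7%N = U%:Z].

(** [j] counts the loop letters fired since the stage was entered. Nothing bounds it, so coordinate
    8 may be negative. *)
Definition at_stage (A T U i j : nat) (X : nat -> int) : Prop :=
  let v := vals chain A T U i in
  guessed A T U X /\
  [/\ X 1%N = i%:Z, X 8%N = v.1.1%:Z - j%:Z, X 9%N = (v.1.2 * 2 ^ j)%:Z,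
      X 10%N = v.2%:Z & forall r, X (Reg r) = 0].

Definition at_state (p : nat) (regs : seq nat) (X : nat -> int) : Prop :=
  X 1%N = (K.+1 + p)%:Z /\ forall r, X (Reg r) = (nth 0%N regs r)%:Z.

(** When coordinate 8 is 0, the number of loops was exactly [e], so coordinate 9 holds [m * 2 ^ e].
    This is how linear updates compute an exponential. *)
Lemma guessed_env A T U i j X (st : nform) :
  okf st -> X 0%N = 1 -> at_stage A T U i j X -> X 8%N = 0 ->
  let v := vals chain A T U i in
  ev (zf st) X = (nev st (env A T U (v.1.2 * 2 ^ v.1.1) v.2))%:Z.
Proof.
move=> ok X0 [[X3 X4 X5 X6 X7] [X1 X8 X9 X10 XR]] block_state v.
have ej : v.1.1 = j by move: X8; rewrite block_state -/v; lia.
apply: ev_zf => p /(allP ok); rewrite /vars !inE.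
by do 7! [case/orP => [/eqP->|]; first by rewrite /= ?X9 -/v ?ej];
  move=> /eqP->; rewrite /= X10.
Qed.

Lemma vals_step A T U i : (i < K)%N ->
  vals chain A T U i.+1 = nxt A T U (vals chain A T U i) (nth stage0 chain i).
Proof.
by move=> iK; rewrite /vals (take_nth stage0 iK) -cats1 foldl_cat.
Qed.

Lemma vals0 A T U : vals chain A T U 0 = (0, 0, 0)%N.
Proof. by rewrite /vals take0. Qed.

Lemma stage_ok i : okst (nth stage0 chain i).
Proof.
case: (ltnP i K) => iK; first by apply: (allP okc); apply: mem_nth.
by rewrite nth_default.
Qed.

(** Replaces the claim that [st] lies on the run from input [c]. Being about results only, it passes
    through a simulated step without counting fuel. *)
Definition resumes (c : nat) (st : mstate) : Prop := forall f res,
  run D f st = Some res -> exists f', run D f' (0%N, [:: c]) = Some res.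

Definition halts0 (c : nat) : Prop := halts_with D c 0.

Definition Inv (X : nat -> int) : Prop :=
  [/\ X 0%N = 1, exists t : nat, X 2%N = t%:Z & exists A T U,
  [\/ exists i j, (i <= K)%N /\ at_stage A T U i j X,
      exists p regs, [/\ X 3%N = (yv A T U)%:Z, at_state p regs X &
                         resumes (cval chain out A T U) (p, regs)] |
      [/\ X 3%N = (yv A T U)%:Z, X 1%N = -1 & halts0 (cval chain out A T U)]]].

Lemma inv_init : Inv Xinit.
Proof.
split=> //; first by exists 0%N.
exists 0%N, 0%N, 0%N; apply: Or31; exists 0%N, 0%N; split=> //.
by rewrite /at_stage vals0; split; split.
Qed.

(** The values at stage 0 do not depend on the guesses, so the guesses may still change there. *)
Lemma guess_step A T U A' T' U' j X X' :
  at_stage A T U 0 j X -> guessed A' T' U' X' ->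
  (forall i, i \notin [:: 3; 4; 5; 6; 7]%N -> X' i = X i) ->
  at_stage A' T' U' 0 j X'.
Proof.
rewrite /at_stage !vals0 => -[_ [X1 X8 X9 X10 XR]] g' E; split=> //.
by split=> [||||r]; rewrite E.
Qed.

Lemma pc0_stage X : Inv X -> X 1%N = 0 ->
  [/\ X 0%N = 1, exists t : nat, X 2%N = t%:Z &
      exists A T U j, at_stage A T U 0 j X].
Proof.
case=> X0 Xt [A [T [U [[i [j [_ st]]]|[p [regs [_ [X1 _] _]]]|[_ X1 _]]]]] E.
- have i0 : i = 0%N by case: st => _ [X1 _ _ _ _]; lia.
  by rewrite i0 in st; split=> //; exists A, T, U, j.
- by lia.
- by rewrite E in X1.
Qed.

Lemma inv_guess A T U A' T' U' j X X' :
  X 0%N = 1 -> (exists t : nat, X 2%N = t%:Z) ->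
  at_stage A T U 0 j X -> guessed A' T' U' X' ->
  (forall i, i \notin [:: 3; 4; 5; 6; 7]%N -> X' i = X i) -> Inv X'.
Proof.
move=> X0 [t Xt] st g' E; split; first by rewrite E.
  by exists t; rewrite E.
exists A', T', U'; apply: Or31; exists 0%N, j; split=> //.
exact: guess_step st g' E.
Qed.

Lemma upd_LA A T U X : X 0%N = 1 -> guessed A T U X -> guessed A.+1 T U (upd LA.2 X).
Proof.
move=> X0 [X3 X4 X5 X6 X7].
by split; rewrite /= ?X3 ?X4 ?X5 ?X6 ?X7 /yv /y2v ?expnS; lia.
Qed.

Lemma upd_LT A T U X : X 0%N = 1 -> guessed A T U X -> guessed A T.+1 U (upd LT.2 X).
Proof.
move=> X0 [X3 X4 X5 X6 X7].
by split; rewrite /= ?X3 ?X4 ?X5 ?X6 ?X7 ?X0 /yv /y2v ?expnS; lia.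
Qed.

Lemma upd_LU A T U X : X 0%N = 1 -> guessed A T U X -> guessed A T U.+1 (upd LU.2 X).
Proof.
move=> X0 [X3 X4 X5 X6 X7].
by split; rewrite /= ?X3 ?X4 ?X5 ?X6 ?X7 ?X0 /yv /y2v ?expnS; lia.
Qed.

Lemma upd_Lloop A T U i j X : X 0%N = 1 -> at_stage A T U i j X ->
  at_stage A T U i j.+1 (upd Lloop.2 X).
Proof.
move=> X0 [g [X1 X8 X9 X10 XR]]; split; first by case: g.
by split=> //=; rewrite ?X8 ?X9 ?X0 ?expnS; lia.
Qed.

Lemma upd_Lst A T U i j X : X 0%N = 1 -> (i < K)%N -> at_stage A T U i j X ->
  X 8%N = 0 -> at_stage A T U i.+1 0 (upd (Lst i (nth stage0 chain i)).2 X).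
Proof.
move=> X0 iK st X8; have /and3P[o1 o2 o3] := stage_ok i.
case: (st) => g [X1 _ _ _ XR]; split; first by case: g.
rewrite vals_step //; split=> //=; rewrite ?X0 ?addr0 ?mulr1 //.
- by rewrite (guessed_env _ _ _ _ _ _ _ o1 X0 st X8).
- by rewrite (guessed_env _ _ _ _ _ _ _ o2 X0 st X8) muln1.
- by rewrite (guessed_env _ _ _ _ _ _ _ o3 X0 st X8).
Qed.

Lemma upd_Lout A T U j X : X 0%N = 1 -> at_stage A T U K j X ->
  X 8%N = 0 -> at_state 0 [:: cval chain out A T U] (upd (Lout K out).2 X).
Proof.
move=> X0 st X8; case: (st) => g [X1 _ _ _ XR].
split=> [|[|r]] /=; first by rewrite X0; lia.
  by rewrite (guessed_env _ _ _ _ _ _ _ oko X0 st X8).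
by rewrite XR nth_nil.
Qed.

Lemma nth_upd r regs v (q : nat) :
  nth 0%N (set_nth 0%N regs r v) q = if q == r then v else nth 0%N regs q.
Proof. by rewrite nth_set_nth. Qed.

Lemma upd_Linc p r regs X : X 0%N = 1 -> at_state p regs X ->
  at_state p.+1 (set_nth 0%N regs r (nth 0%N regs r).+1) (upd (Linc K.+1 p r).2 X).
Proof.
move=> X0 [X1 XR]; split=> [|q] /=; first by rewrite X0; lia.
rewrite !eqSS nth_upd; case: eqP => _; rewrite !XR ?X0 /=; lia.
Qed.

Lemma upd_Ldz p r j regs X : X 0%N = 1 -> at_state p regs X ->
  at_state j regs (upd (Ldz K.+1 p r j).2 X).
Proof. by move=> X0 [X1 XR]; split=> [|q] /=; rewrite ?XR ?X0; lia. Qed.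

Lemma upd_Ldn p r regs X : X 0%N = 1 -> (0 < nth 0%N regs r)%N -> at_state p regs X ->
  at_state p.+1 (set_nth 0%N regs r (nth 0%N regs r).-1) (upd (Ldn K.+1 p r).2 X).
Proof.
move=> X0 pos [X1 XR]; split=> [|q] /=; first by rewrite X0; lia.
rewrite !eqSS nth_upd; case: eqP => _; rewrite !XR ?X0; lia.
Qed.

Lemma resumes_step c p regs st' : (p < size D)%N -> step D (p, regs) = Some st' ->
  resumes c (p, regs) -> resumes c st'.
Proof.
move=> pD st rs f res rf; apply: (rs f.+1).
by rewrite (run_step _ _ (p, regs) _ pD st).
Qed.

(** A counter above [K] rules out both the stages and the accepted phase, where it is -1. *)
Lemma state_of X p : Inv X -> X 1%N = (K.+1 + p)%:Z ->
  exists A T U regs, [/\ X 3%N = (yv A T U)%:Z, at_state p regs X &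
     resumes (cval chain out A T U) (p, regs)].
Proof.
case=> X0 Xt [A [T [U [[i [j [iK [_ [X1 _ _ _ _]]]]]|[p' [regs [X3 [X1 XR] rs]]]|[_ X1 _]]]]] E.
- by move: E; rewrite X1; lia.
- have pp : p' = p by lia.
  by rewrite pp in X1 rs; exists A, T, U, regs.
- by rewrite E in X1.
Qed.

Lemma Inv_state X p regs A T U : X 0%N = 1 -> (exists t : nat, X 2%N = t%:Z) ->
  X 3%N = (yv A T U)%:Z -> at_state p regs X ->
  resumes (cval chain out A T U) (p, regs) -> Inv X.
Proof.
move=> X0 Xt X3 st rs; split=> //; exists A, T, U; apply: Or32.
by exists p, regs.
Qed.

Lemma ev_pc c X : X 0%N = 1 -> ev [:: (1, 1%N); (- c, 0%N)] X = 0 -> X 1%N = c.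
Proof. by move=> X0 /=; rewrite X0; lia. Qed.

Lemma inv_D p a X : (p < size D)%N -> a \in Dlets K.+1 D p -> legal a X ->
  Inv X -> Inv (upd a.2 X).
Proof.
move=> pD; rewrite /Dlets.
case En: (nth _ D p) => [r|r j]; rewrite !inE.
  move/eqP=> -> /andP[/eqP/ev_pc pc _] iv; have [X0 Xt _] := iv.
  have [A [T [U [regs [X3 st rs]]]]] := state_of _ _ iv (pc X0).
  apply: (Inv_state _ _ _ A T U _ _ _ (upd_Linc _ r _ _ X0 st)) => //.
  by apply: resumes_step rs => //=; rewrite En.
case/orP=> /eqP-> /and3P[/eqP/ev_pc pc /eqP zr _] iv; have [X0 [t Xt] _] := iv;
  have [A [T [U [regs [X3 st rs]]]]] := state_of _ _ iv (pc X0);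
  have XR := st.2 r.
  have z0 : nth 0%N regs r = 0%N by move: zr; rewrite /= XR; lia.
  apply: (Inv_state _ _ _ A T U _ _ _ (upd_Ldz _ r j _ _ X0 st)) => //.
    by exists t.
  by apply: resumes_step rs => //=; rewrite En z0.
have zp : (0 < nth 0%N regs r)%N by move: zr; rewrite /= XR Xt X0; lia.
apply: (Inv_state _ _ _ A T U _ _ _ (upd_Ldn _ r _ _ X0 zp st)) => //.
  by exists 0%N.
by apply: resumes_step rs => //=; rewrite En -[_ == 0%N]negbK -lt0n zp.
Qed.

Lemma inv_step a X : a \in ls -> legal a X -> Inv X -> Inv (upd a.2 X).
Proof.
rewrite /lets !mem_cat !inE => /orP[|/orP[]]; last 2 first.
- case/mapP=> i; rewrite mem_iota => /andP[_ iK] -> /and3P[/eqP/ev_pc pc /eqP e0 _] iv.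
  have [X0 Xt [A [T [U H]]]] := iv.
  have {e0} e0 : X 8%N = 0 by move: e0 => /=; lia.
  have {}pc := pc X0.
  split=> //; exists A, T, U; apply: Or31.
  case: H => [[i' [j [iK' st]]]|[p [regs [_ [X1 _] _]]]|[_ X1 _]].
  + have ii : i' = i by case: (st) => _ [X1 _ _ _ _]; lia.
    rewrite ii in st; exists i.+1, 0%N; split=> //.
    exact: upd_Lst st e0.
  + by move: X1; rewrite pc; lia.
  + by rewrite pc in X1.
- by case/flattenP=> l /mapP[p]; rewrite mem_iota => /andP[_ pD] ->; apply: inv_D.
case/or4P=> [/eqP->|/eqP->|/eqP->|/or4P[]/eqP->] la iv; have [X0 [t Xt] H] := iv.
- split=> //; first by exists t.+1; rewrite /= Xt X0; lia.
- split=> //; first by exists t.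
  case: H => A [T [U H]]; exists A, T, U.
  case: H => [[i [j [iK st]]]|[p [regs [X3 st rs]]]|H]; last by apply: Or33.
    by apply: Or31; exists i, j.+1; split=> //; apply: upd_Lloop.
  by apply: Or32; exists p, regs.
- move: la => /andP[/eqP pc _]; have {}pc : X 1%N = 0 by move: pc => /=; lia.
  have [_ Xt' [A' [T' [U' [j st]]]]] := pc0_stage _ iv pc.
  apply: (inv_guess _ _ _ A'.+1 T' U' _ _ _ X0 Xt' st); first exact: upd_LA st.1.
  by move=> i; rewrite !inE /= !negb_or; case/and5P=> /negPf-> /negPf-> /negPf->.
- move: la => /andP[/eqP pc _]; have {}pc : X 1%N = 0 by move: pc => /=; lia.
  have [_ Xt' [A' [T' [U' [j st]]]]] := pc0_stage _ iv pc.
  apply: (inv_guess _ _ _ A' T'.+1 U' _ _ _ X0 Xt' st); first exact: upd_LT st.1.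
  by move=> i; rewrite !inE /= !negb_or; case/and5P=> /negPf-> /negPf-> _ /negPf->.
- move: la => /andP[/eqP pc _]; have {}pc : X 1%N = 0 by move: pc => /=; lia.
  have [_ Xt' [A' [T' [U' [j st]]]]] := pc0_stage _ iv pc.
  apply: (inv_guess _ _ _ A' T' U'.+1 _ _ _ X0 Xt' st); first exact: upd_LU st.1.
  by move=> i; rewrite !inE /= !negb_or; case/and5P=> /negPf-> /negPf-> _ _ /negPf->.
- move: la => /and3P[/eqP/ev_pc pc /eqP e0 _].
  have {e0} e0 : X 8%N = 0 by move: e0 => /=; lia.
  have {}pc := pc X0.
  case: H => A [T [U]] [[i [j [iK' st]]]|[p [regs [_ [X1 _] _]]]|[_ X1 _]].
  + have ii : i = K by case: (st) => _ [X1 _ _ _ _]; lia.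
    rewrite ii in st; apply: (Inv_state _ _ _ A T U _ _ _ (upd_Lout _ _ _ _ _ X0 st e0)) => //.
    * by exists 0%N.
    * by case: st => [[X3 _ _ _ _] _].
    * by move=> f res rf; exists f.
  + by move: X1; rewrite pc; lia.
  + by rewrite pc in X1.
- move: la => /and3P[/eqP pc /eqP r0 _].
  have {}pc : X 1%N = (K.+1 + (size D + t))%:Z by move: pc; rewrite /= X0 Xt; lia.
  have [A [T [U [regs [X3 [X1 XR] rs]]]]] := state_of _ _ iv pc.
  split=> //; first by exists t.
  exists A, T, U; apply: Or33; split=> //=; first by rewrite X0.
  (* The state is already past the end of [D], so a run with fuel 1 returns it at once, and
     [resumes] turns this into a run from the input. *)
  have [|f rf] := rs 1%N (size D + t, regs)%N; first by rewrite /= leq_addr.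
  exists f, (size D + t, regs)%N; split=> //=.
  by apply/eqP; rewrite -eqz_nat -XR; move: r0 => /=; lia.
Qed.

Lemma reach_inv X : reach ls Xinit X -> Inv X.
Proof. by elim=> [|a {}X al la _]; [exact: inv_init | exact: inv_step]. Qed.

Lemma reach_sound X : reach ls Xinit X -> X 1%N = -1 ->
  exists A T U, X 3%N = (yv A T U)%:Z /\ halts_with D (cval chain out A T U) 0.
Proof.
move/reach_inv=> [X0 Xt [A [T [U [[i [j [_ [_ [X1 _ _ _ _]]]]]|[p [regs [_ [X1 _] _]]]|[X3 _ h]]]]]] E.
- by rewrite E in X1.
- by rewrite E in X1.
- by exists A, T, U.
Qed.

(** * Completeness: a halting run of [D] with output 0 gives an accepting word *)

Definition visits (P : (nat -> int) -> Prop) : Prop :=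
  exists X, [/\ reach ls Xinit X, X 0%N = 1, X 2%N = 0 & P X].

Lemma visits_step (P Q : (nat -> int) -> Prop) a :
  a \in ls -> (forall X, X 0%N = 1 -> X 2%N = 0 -> P X ->
    [/\ legal a X, upd a.2 X 0%N = 1, upd a.2 X 2%N = 0 & Q (upd a.2 X)]) ->
  visits P -> visits Q.
Proof.
move=> al H [X [rX X0 X2 PX]]; have [la Y0 Y2 QY] := H X X0 X2 PX.
by exists (upd a.2 X); split=> //; apply: reachS.
Qed.

Lemma visits_guess A T U : visits (at_stage A T U 0 0).
Proof.
have legal0 a X : X 1%N = 0 -> X 0%N = 1 -> a \in [:: LA; LT; LU] -> legal a X.
  by move=> X1 X0; rewrite !inE => /or3P[]/eqP-> /=; rewrite /legal /= X1.
have in_guess a : a \in [:: LA; LT; LU] -> a \in ls.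
  by rewrite /lets mem_cat !inE => /or3P[]-> ; rewrite ?orbT.
have [al tl ul] : [/\ LA \in [:: LA; LT; LU], LT \in [:: LA; LT; LU] & LU \in [:: LA; LT; LU]].
  by rewrite !inE !eqxx !orbT.
elim: A => [|A IH].
  elim: T => [|T IH].
    elim: U => [|U IH].
      exists Xinit; split=> //; first by exact: reach0.
      by rewrite /at_stage vals0.
    apply: visits_step IH; first exact: (in_guess _ ul).
    move=> X X0 X2 st; have X1 : X 1%N = 0 by case: st => _ [].
    split=> //; first by apply: legal0.
    apply: (guess_step _ _ _ _ _ _ _ _ _ st); first by apply: upd_LU => //; case: st.
    by move=> i; rewrite !inE /= !negb_or; case/and5P=> /negPf-> /negPf-> _ _ /negPf->.
  apply: visits_step IH; first exact: (in_guess _ tl).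
  move=> X X0 X2 st; have X1 : X 1%N = 0 by case: st => _ [].
  split=> //; first by apply: legal0.
  apply: (guess_step _ _ _ _ _ _ _ _ _ st); first by apply: upd_LT => //; case: st.
  by move=> i; rewrite !inE /= !negb_or; case/and5P=> /negPf-> /negPf-> _ /negPf->.
apply: visits_step IH; first exact: (in_guess _ al).
move=> X X0 X2 st; have X1 : X 1%N = 0 by case: st => _ [].
split=> //; first by apply: legal0.
apply: (guess_step _ _ _ _ _ _ _ _ _ st); first by apply: upd_LA => //; case: st.
by move=> i; rewrite !inE /= !negb_or; case/and5P=> /negPf-> /negPf-> /negPf->.
Qed.

Lemma visits_loop A T U i j :
  visits (at_stage A T U i 0) -> visits (at_stage A T U i j).
Proof.
move=> H0; elim: j => // j IH; apply: visits_step IH.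
  exact: (mem_nth Ltick (s := ls) (n := 1)).
by move=> X X0 X2 st; split=> //; apply: upd_Lloop.
Qed.

Lemma stage_exit A T U i X (v := vals chain A T U i) :
  at_stage A T U i v.1.1 X -> X 8%N = 0.
Proof. by move=> [_ [_ X8 _ _ _]]; rewrite X8 -/v; lia. Qed.

Lemma visits_stage A T U i : (i <= K)%N -> visits (at_stage A T U i 0).
Proof.
elim: i => [|i IH] iK; first exact: visits_guess.
have := visits_loop _ _ _ _ (vals chain A T U i).1.1 (IH (ltnW iK)).
apply: visits_step (Lst i (nth stage0 chain i)) _ _.
  rewrite /lets !mem_cat; apply/orP; right; apply/orP; left.
  by apply/mapP; exists i; rewrite // mem_iota.
move=> X X0 X2 st; have e0 := stage_exit _ _ _ _ _ st.
split=> //; last exact: upd_Lst st e0.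
case: st => _ [X1 _ _ _ _].
by rewrite /legal /= X1 e0 X0; apply/andP; split; apply/eqP; lia.
Qed.

Definition at_state_y (y p : nat) (regs : seq nat) (X : nat -> int) : Prop :=
  X 3%N = y%:Z /\ at_state p regs X.

Lemma visits_start A T U :
  visits (at_state_y (yv A T U) 0 [:: cval chain out A T U]).
Proof.
have := visits_loop _ _ _ _ (vals chain A T U K).1.1 (visits_stage A T U K (leqnn _)).
apply: visits_step (Lout K out) _ _; first exact: (mem_nth Ltick (s := ls) (n := 5)).
move=> X X0 X2 st; have e0 := stage_exit _ _ _ _ _ st.
split=> //; last by split; [case: st => -[] | exact: upd_Lout st e0].
case: st => _ [X1 _ _ _ _].
by rewrite /legal /= X1 e0 X0; apply/andP; split; apply/eqP; lia.
Qed.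

(** [visits] keeps the tick count at 0; a letter whose check mentions ticks is prepared by inserting
    exactly the number it asks for. *)
Lemma visits_tick y p regs m : visits (at_state_y y p regs) ->
  exists X, [/\ reach ls Xinit X, X 0%N = 1, X 2%N = m%:Z & at_state_y y p regs X].
Proof.
move=> [X [rX X0 X2 st]]; elim: m => [|m [Y [rY Y0 Y2 sY]]]; first by exists X.
exists (upd Ltick.2 Y); split=> //; last by rewrite /= Y0 Y2; lia.
by apply: reachS => //; apply: (mem_nth Ltick (s := ls) (n := 0)).
Qed.

Lemma mem_Dlets p a : (p < size D)%N -> a \in Dlets K.+1 D p -> a \in ls.
Proof.
move=> pD aD; rewrite /lets !mem_cat; apply/orP; right; apply/orP; right.
by apply/flattenP; exists (Dlets K.+1 D p) => //; apply: map_f; rewrite mem_iota.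
Qed.

Lemma visits_Dstep y p regs st' : (p < size D)%N -> step D (p, regs) = Some st' ->
  visits (at_state_y y p regs) -> visits (at_state_y y st'.1 st'.2).
Proof.
move=> pD; rewrite /step; have mem a := mem_Dlets p a pD; move: mem.
rewrite /Dlets; case: (nth _ D p) => [r|r j] mem.
  case=> <-; apply: visits_step (Linc K.+1 p r) (mem _ _) _; first by rewrite inE.
  move=> X X0 X2 [X3 st]; split=> //; last by split=> //; apply: upd_Linc.
  by rewrite /legal /= st.1 X0 andbT; apply/eqP; lia.
case: ifP => [/eqP r0 [<-]|rn [<-]].
  apply: visits_step (Ldz K.+1 p r j) (mem _ _) _; first by rewrite inE eqxx.
  move=> X X0 X2 [X3 st]; split=> //; last by split=> //; apply: upd_Ldz st.
  by rewrite /legal /= st.1 st.2 X0 r0; apply/andP; split; apply/eqP; lia.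
(* One tick less than the register satisfies the check of the decrement letter, which then resets
   the ticks to 0. *)
move=> /(visits_tick _ _ _ (nth 0%N regs r).-1) [X [rX X0 X2 [X3 st]]].
exists (upd (Ldn K.+1 p r).2 X); split=> //; last first.
  by split=> //; apply: upd_Ldn => //; rewrite lt0n rn.
apply: reachS => //; first by apply: mem; rewrite !inE eqxx orbT.
by rewrite /legal /= st.1 st.2 X0 X2; apply/and3P; split=> //; apply/eqP; lia.
Qed.

Lemma visits_run y f p regs p' regs' : run D f (p, regs) = Some (p', regs') ->
  visits (at_state_y y p regs) ->
  (size D <= p')%N /\ visits (at_state_y y p' regs').
Proof.
elim: f p regs => [|f IH] p regs.
  by rewrite /=; case: ifP => // sp [<- <-].
case: (leqP (size D) p) => sp; first by rewrite /= sp => -[<- <-].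
case E: (step D (p, regs)) => [[q rs]|]; last by cbn [run]; rewrite leqNgt sp E.
rewrite (run_step _ _ (p, regs) _ sp E) => /IH H /(visits_Dstep _ _ _ _ sp E).
exact: H.
Qed.

Lemma reach_complete A T U : halts_with D (cval chain out A T U) 0 ->
  exists X, [/\ reach ls Xinit X, X 1%N = -1 & X 3%N = (yv A T U)%:Z].
Proof.
move=> [f [[p regs] [rf r0]]].
have [sp] := visits_run _ _ _ _ _ _ rf (visits_start A T U).
(* The ticks make up for the distance by which the final address overshoots the end of [D]. *)
move=> /(visits_tick _ _ _ (p - size D)%N) [X [rX X0 X2 [X3 [X1 XR]]]].
exists (upd (Lhalt (K.+1 + size D)).2 X); split=> //; last by rewrite /= X0.
apply: reachS => //; first exact: (mem_nth Ltick (s := ls) (n := 6)).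
rewrite /legal /= X1 X0 X2 XR /= in r0 *.
by rewrite r0; apply/and3P; split=> //; apply/eqP; lia.
Qed.

End Simulation.

(** * Matrices for the block values *)

Import VectorInternalTheory.

(** Lets the state space be built as an abstract vector space with linear maps; the matrices come
    from a choice of basis. *)
Lemma linear_mx (F : fieldType) (V : vectType F) (k : nat) (f : V -> 'cV[F]_k) :
  linear f -> exists M : 'M[F]_(k, dim V), forall x, M *m (v2r x)^T = f x.
Proof.
move=> lf; pose h (r : 'rV_(dim V)) : 'rV_k := (f (r2v r))^T.
have lh : linear h by move=> a x y; rewrite /h linearP lf linearP.
pose hL : {linear 'rV_(dim V) -> 'rV_k} := HB.pack h (GRing.isLinear.Build _ _ _ _ h lh).
exists (lin1_mx hL)^T => x.
by rewrite -trmx_mul mul_rV_lin1 /= /h v2rK trmxK.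
Qed.

Lemma linear_mx_endo (F : fieldType) (V : vectType F) (f : V -> V) :
  linear f -> exists M : 'M[F]_(dim V), forall x, M *m (v2r x)^T = (v2r (f x))^T.
Proof. by move=> lf; apply: linear_mx => a x y; rewrite lf !linearP. Qed.

Section Forms.
Variable n : nat.
Local Notation N := n.+1.

Definition bdf (l : lform) : bool := all (fun p => p.2 < N)%N l.
Definition bdl (a : letter) : bool :=
  all bdf a.1 && all (fun q => bdf q.2) a.2.

Definition rowf (l : lform) : 'rV[rat]_N :=
  \row_j \sum_(p <- l) p.1%:~R *+ (p.2 == j).
Definition colv (X : nat -> int) : 'cV[rat]_N := \col_i (X i)%:~R.

Lemma rowf_ev l X : bdf l -> rowf l *m colv X = ((ev l X)%:~R)%:M.
Proof.
move=> bl; apply/matrixP=> i j; rewrite !mxE !ord1 eqxx mulr1n.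
under eq_bigr => k _ do rewrite !mxE mulr_suml.
rewrite exchange_big /=; elim: l bl => [|p l IH] /=; first by rewrite big_nil.
case/andP=> pN /IH{}IH; rewrite big_cons IH rmorphD rmorphM /=; congr (_ + _).
rewrite (bigD1 (Ordinal pN)) //= eqxx mulr1n big1 ?addr0 // => k kp.
rewrite (_ : (_ == _) = false) ?mulr0n ?mul0r //.
by apply: contraNF kp => /eqP pk; apply/eqP/val_inj.
Qed.

Definition updf (asg : seq (nat * lform)) (i : nat) : lform :=
  foldr (fun p acc => if i == p.1 then p.2 else acc) [:: (1, i)] asg.

Lemma ev_updf asg i X : ev (updf asg i) X = upd asg X i.
Proof.
rewrite /upd; elim: asg => [|p asg IH] /=; first by rewrite mul1r addr0.
by case: eqP.
Qed.

Lemma bdf_updf asg i : (i < N)%N -> all (fun q => bdf q.2) asg -> bdf (updf asg i).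
Proof.
by move=> iN; elim: asg => [|p asg IH] /=; [rewrite /bdf /= iN | case/andP=> pN /IH; case: eqP].
Qed.

Definition matL (a : letter) : 'M[rat]_N := \matrix_(i, j) rowf (updf a.2 i) 0 j.

Lemma matL_upd a X : bdl a -> matL a *m colv X = colv (upd a.2 X).
Proof.
case/andP=> _ ba; apply/matrixP=> i j; rewrite !ord1 [in RHS]mxE -ev_updf.
have := rowf_ev (updf a.2 i) X (bdf_updf _ _ (ltn_ord i) ba).
move=> /matrixP/(_ 0 0); rewrite !mxE eqxx mulr1n => <-.
by apply: eq_bigr => k _; rewrite !mxE.
Qed.

(** The components are a constant, a multiple of [x x^T] for the current coordinate vector [x], and
    the scaled penalty. Keeping [x x^T] instead of [x] makes squares of linear forms linear in the
    state. *)
Definition block_state : Type := (rat^o * 'M[rat]_N * rat^o)%type.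
HB.instance Definition _ := Vector.on block_state.

Definition quad (l : 'rV[rat]_N) (Y : 'M[rat]_N) : rat := (l *m Y *m l^T) 0 0.

Lemma quad_linear l : linear (quad l : _ -> rat^o).
Proof.
move=> a x y.
by rewrite /quad mulmxDr mulmxDl -scalemxAr -scalemxAl !mxE.
Qed.

Lemma quad_colv l X c : bdf l ->
  quad (rowf l) (c *: (colv X *m (colv X)^T)) = c * ((ev l X)%:~R ^+ 2).
Proof.
move=> bl; rewrite /quad -scalemxAr -scalemxAl mulmxA rowf_ev // -mulmxA -trmx_mul.
by rewrite rowf_ev // tr_scalar_mx -scalar_mxM !mxE eqxx mulr1n expr2.
Qed.

Variables (ls : seq letter) (X0 : nat -> int) (delta kap : rat).
Local Notation p := (size ls).

Definition stepL (a : letter) (s : block_state) : block_state :=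
  (s.1.1, delta *: (matL a *m s.1.2 *m (matL a)^T),
   delta * (s.2 + \sum_(l <- a.1) quad (rowf l) s.1.2)).

Lemma stepL_linear a : linear (stepL a).
Proof.
move=> c [[x1 x2] x3] [[y1 y2] y3]; rewrite /stepL /=; congr (_, _, _) => /=.
- rewrite mulmxDr mulmxDl -scalemxAr -scalemxAl scalerDr !scalerA.
  by rewrite [delta * c]mulrC.
- under eq_bigr => l _ do rewrite quad_linear.
  by rewrite big_split /GRing.scale /= -mulr_sumr; ring.
Qed.

(* the form pc + 1, in terms of the constant coordinate 0 *)
Definition finf : lform := [:: (1, 1%N); (1, 0%N)].
Local Notation oo := (inord 0 : 'I_N).
Local Notation oy := (inord 3 : 'I_N).

(** Since [rho^2 - (y_u rho - 1)^2 = rho^2 (1 - y_u^2) + 2 y_u rho - 1], the value of a block splits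
    into a part free of [rho], which is [val0], and the coefficients [phi1] of [rho^2] and [phi2] of
    [rho]. *)
Definition val0 (s : block_state) : rat :=
  s.1.1 - s.1.2 oo oo - s.2 - quad (rowf finf) s.1.2.
Definition phi1 (s : block_state) : rat := s.1.2 oo oo - s.1.2 oy oy.
Definition phi2 (s : block_state) : rat := 2 * s.1.2 oy oo.
Definition w0 : block_state := (1, kap *: (colv X0 *m (colv X0)^T), 0).

Lemma val0_linear : linear (val0 : _ -> rat^o).
Proof.
move=> c [[x1 x2] x3] [[y1 y2] y3]; rewrite /val0 /= quad_linear !mxE /GRing.scale /=; ring.
Qed.

Definition desc (c : rat) (u : seq letter) : block_state :=
  let d := c * kap * delta ^+ size u in
  (c, d *: (colv (sem X0 u) *m (colv (sem X0 u))^T), d * (pen X0 u)%:~R).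

Lemma stepL_desc a c u : bdl a -> stepL a (desc c u) = desc c (a :: u).
Proof.
move=> ba; have /andP[/allP ba1 _] := ba.
rewrite /stepL /desc /= !exprS; congr (_, _, _).
- rewrite -scalemxAr -scalemxAl mulmxA matL_upd // -mulmxA -trmx_mul matL_upd //.
  by rewrite scalerA mulrCA.
- under eq_big_seq => l la do rewrite quad_colv ?ba1 //.
  rewrite -mulr_sumr rmorphD rmorph_sum /=.
  by under [in RHS]eq_bigr => l _ do rewrite rmorphXn /=; ring.
Qed.

Lemma w0_desc c : c *: w0 = desc c [::].
Proof. by rewrite /w0 /desc /= expr0 mulr0 !mulr1; congr (_, _, _); rewrite /= ?scalerA /GRing.scale /= ?mulr1 ?mulr0. Qed.

Definition gval (rho : rat) (u : seq letter) : rat :=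
  let X := sem X0 u in
  1 + kap * delta ^+ size u *
    (rho ^+ 2 - ((X 3%N)%:~R * rho - 1) ^+ 2 - (pen X0 u)%:~R
     - (X 1%N + 1)%:~R ^+ 2).

Lemma val_desc rho c u : (3 < N)%N -> sem X0 u 0%N = 1 ->
  val0 (desc c u) + (rho ^+ 2 * phi1 (desc c u) + rho * phi2 (desc c u))
  = c * gval rho u.
Proof.
move=> N3 s0; rewrite /val0 /phi1 /phi2 /desc /= quad_colv; last first.
  by rewrite /bdf /= (ltn_trans _ N3).
rewrite !mxE !big_ord1 !mxE !inordK // s0 /gval.
have -> : ev finf (sem X0 u) = sem X0 u 1%N + 1 by rewrite /= s0; ring.
by rewrite rmorphD /=; ring.
Qed.

(** * The automaton that splits digit strings into letters and blocks *)

Definition phase_state : Type := {ffun 'I_p.+1 -> block_state}.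
HB.instance Definition _ := Vector.on phase_state.

Definition at_ph (i : 'I_p.+1) (s : block_state) : phase_state := [ffun j => if j == i then s else 0].

(** A phase counts the zeros read since the last nonzero digit, modulo [p + 1]. Being cyclic, it
    gives every digit string a meaning, however long its runs of zeros. *)
Definition shift (S : phase_state) : phase_state := [ffun i => S (ord_pred i)].
(** The effect of a nonzero digit: the last phase acts as the separator and restarts from [w0]. Only
    the part of the block value free of [rho] is used here. *)
Definition fire (S : phase_state) : phase_state :=
  at_ph ord0 (\sum_(j < p) stepL (nth Ltick ls j) (S (widen_ord (leqnSn p) j))
              + val0 (S ord_max) *: w0).
(** The phase from which one more 0 leads into the last one. The matrix of the nonzero digits is to
    be free of [rho], so the [rho] terms of a block value are prepared one digit early: that 0
    stores them in the first coordinate, and the next nonzero digit adds them to [val0]. *)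
Definition ready (S : phase_state) : block_state := S (ord_pred ord_max).
Definition outv (S : phase_state) : rat := \sum_i (S i).1.1.

Lemma at_ph_linear i : linear (at_ph i).
Proof.
move=> c x y; apply/ffunP=> j; rewrite !ffunE; case: eqP => // _.
by rewrite scaler0 addr0.
Qed.

Lemma shift_linear : linear shift.
Proof. by move=> c x y; apply/ffunP=> j; rewrite !ffunE. Qed.

Lemma fire_linear : linear fire.
Proof.
move=> c x y; rewrite /fire -at_ph_linear; congr (at_ph _ _).
rewrite scalerDr scaler_sumr addrACA -big_split /=; congr (_ + _).
  by apply: eq_bigr => j _; rewrite !ffunE stepL_linear.
by rewrite !ffunE val0_linear scalerDl scalerA.
Qed.

Lemma outv_linear : linear (outv : _ -> rat^o).
Proof.
move=> c x y; rewrite /outv scaler_sumr -big_split /=.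
by apply: eq_bigr => j _; rewrite !ffunE.
Qed.

Lemma shift_at i s : shift (at_ph i s) = at_ph (ordS i) s.
Proof.
apply/ffunP=> j; rewrite !ffunE; congr (if _ then _ else _).
by apply/eqP/eqP => [<-|->]; rewrite ?ord_predK ?ordSK.
Qed.

Lemma stepL0 a : stepL a 0 = 0.
Proof. by have := stepL_linear a (-1) 0 0; rewrite scaler0 addr0 scaleN1r addNr. Qed.

Lemma val00 : val0 0 = 0.
Proof. by have := val0_linear (-1) 0 0; rewrite scaler0 addr0 scaleN1r addNr. Qed.

Lemma fire_at (i : 'I_p.+1) s : fire (at_ph i s) =
  at_ph ord0 (if i == ord_max then val0 s *: w0 else stepL (nth Ltick ls i) s).
Proof.
rewrite /fire; congr (at_ph _ _); rewrite [X in val0 X]ffunE eq_sym; case: eqP => im.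
  rewrite big1 ?add0r // => j _; rewrite ffunE im.
  have /negPf-> : widen_ord (leqnSn p) j != ord_max by rewrite -val_eqE /= neq_ltn ltn_ord.
  exact: stepL0.
have ip : (i < p)%N.
  by rewrite ltn_neqAle -ltnS ltn_ord andbT; apply/eqP => E; apply/im/val_inj.
rewrite val00 scale0r addr0 (bigD1 (Ordinal ip)) //= big1 ?addr0; last first.
  move=> j ji; rewrite ffunE (_ : (_ == _) = false) ?stepL0 //.
  by apply: contraNF ji => /eqP E; apply/eqP/val_inj; rewrite /= -E.
have -> : widen_ord (leqnSn p) (Ordinal ip) = i by apply: val_inj.
by rewrite ffunE eqxx.
Qed.

Lemma outv_at i s : outv (at_ph i s) = s.1.1.
Proof.
rewrite /outv (bigD1 i) //= ffunE eqxx big1 ?addr0 // => j /negPf ji.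
by rewrite ffunE ji.
Qed.

(* (phase, product of the values of the completed blocks, current block) after reading the
   digits ds, most significant first *)
Fixpoint absr (rho : rat) (ds : seq nat) : 'I_p.+1 * rat * seq letter :=
  match ds with
  | [::] => (ord0, 1, [::])
  | d :: ds' =>
    let: (i, c, u) := absr rho ds' in
    if d == 0%N then (ordS i, c, u)
    else if i == ord_max then (ord0, c * gval rho u, [::])
    else (ord0, c, nth Ltick ls i :: u)
  end.

Definition rhorow (rho : rat) : 'rV[rat]_2 := row_mx (rho ^+ 2)%:M (rho%:M : 'M_1).

Definition Mat0 (q : nat) (C0 : 'M[rat]_(2 + q, 1 + (2 + q))) (rho : rat) :
  'M[rat]_(1 + (2 + q)) :=
  col_mx (row_mx 0 (row_mx (rhorow rho) 0)) C0.

Hypotheses (ls_gt0 : (0 < p)%N) (n3 : (3 < N)%N) (bls : all bdl ls).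
Hypothesis (X00 : forall u, all (mem ls) u -> sem X0 u 0%N = 1).

(** Everything except the first row of the matrix of digit 0 is chosen before [rho], so that [y] may
    later be made from the codes of these parts. Digits matter only as zero or nonzero, hence two
    matrices suffice. *)
Lemma representation : exists q (C0 : 'M[rat]_(2 + q, 1 + (2 + q)))
    (M1 : 'M[rat]_(1 + (2 + q))) (w : 'cV[rat]_(1 + (2 + q)))
    (v : 'rV[rat]_(1 + (2 + q))), forall rho ds,
  v *m foldr (fun d acc => (if d == 0%N then Mat0 q C0 rho else M1) *m acc) w ds
  = ((absr rho ds).1.2)%:M.
Proof.
pose q := dim (phase_state : vectType rat); pose vS (S : phase_state) : 'cV[rat]_q := (v2r S)^T.
have [Sh ShE] := linear_mx_endo _ _ _ shift_linear.
have [Ap ApE] := linear_mx_endo _ _ _ fire_linear.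
pose phi (S : phase_state) : 'cV[rat]_2 := col_mx (phi1 (ready S))%:M ((phi2 (ready S))%:M : 'M_1).
have [Ph PhE] : exists M : 'M_(2, q), forall S, M *m vS S = phi S.
  apply: linear_mx => c x y; apply/matrixP=> i j; rewrite !mxE.
  by case: split => k; rewrite !mxE !ord1 eqxx !mulr1n /phi1 /phi2 /ready !ffunE /= !mxE; ring.
have [ou ouE] : exists M : 'M_(1, q), forall S, M *m vS S = (outv S)%:M.
  apply: linear_mx => c x y; apply/matrixP=> i j.
  by rewrite outv_linear !mxE !ord1 eqxx !mulr1n.
pose wS := at_ph ord0 w0.
pose C0 : 'M_(2 + q, 1 + (2 + q)) :=
  col_mx (row_mx 0 (row_mx 0 (Ph *m Sh))) (row_mx 0 (row_mx 0 Sh)).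
pose M1 : 'M_(1 + (2 + q)) :=
  col_mx 0 (col_mx (row_mx (phi wS) (row_mx 0 (Ph *m Ap)))
                   (row_mx (vS wS) (row_mx 0 Ap))).
(* [phi S] is a function of [S]; carrying it explicitly lets the first row reach it with just the
   two entries [rho ^+ 2] and [rho]. *)
pose full (k : rat) (S : phase_state) : 'cV[rat]_(1 + (2 + q)) :=
  col_mx k%:M (col_mx (phi S) (vS S)).
pose v : 'rV_(1 + (2 + q)) := row_mx 0 (row_mx 0 ou).
exists q, C0, M1, (full 0 wS), v => rho ds.
have M0full k S : Mat0 q C0 rho *m full k S =
    full (rho ^+ 2 * phi1 (ready S) + rho * phi2 (ready S)) (shift S).
  rewrite /Mat0 /full !mul_col_mx !mul_row_col !mul0mx !add0r addr0.
  congr col_mx; last by rewrite -mulmxA /vS ShE PhE.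
  apply: etrans (@mul_row_col rat 1 1 1 1 _ _ _ _) _.
  by rewrite -!scalar_mxM -raddfD.
have M1full k S : M1 *m full k S = full 0 (fire S + k *: wS).
  have vSD : vS (fire S + k *: wS) = vS (fire S) + k *: vS wS.
    by rewrite /vS linearD linearZ linearD linearZ.
  have phiD : phi (fire S + k *: wS) = Ph *m Ap *m vS S + k *: phi wS.
    by rewrite -!PhE vSD mulmxDr -scalemxAr -mulmxA [Ap *m _]ApE.
  rewrite /M1 /full !mul_col_mx !mul_row_col !mul0mx !add0r phiD vSD.
  rewrite -[vS (fire S)]ApE !mul_mx_scalar raddf0.
  by rewrite [k *: phi wS + _]addrC [k *: vS wS + _]addrC.
have ordmax0 : (ord0 : 'I_p.+1) == ord_max = false.
  by apply/negbTE; rewrite -val_eqE /= neq_ltn ls_gt0.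
have phi0 : (phi1 0 = 0) * (phi2 0 = 0).
  by rewrite /phi1 /phi2 !mxE subr0 mulr0.
(* The first coordinate is 0 outside the last phase, where it stores the [rho] terms of the block
   about to be closed. *)
have inv : let: (i, c, u) := absr rho ds in
  foldr (fun d acc => (if d == 0%N then Mat0 q C0 rho else M1) *m acc) (full 0 wS) ds =
  full (if i == ord_max then rho ^+ 2 * phi1 (desc c u) + rho * phi2 (desc c u) else 0)
    (at_ph i (desc c u)) /\ all (mem ls) u.
  elim: ds => [|d ds IH] /=.
    rewrite ordmax0; split=> //; congr (full 0 _); congr (at_ph _ _).
    by rewrite -w0_desc scale1r.
  case: (absr rho ds) IH => [[i c] u] [-> uok].
  case: eqP => _.
    split=> //; rewrite M0full shift_at /ready ffunE.
    have -> : (ord_pred ord_max == i) = (ordS i == ord_max).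
      by apply/eqP/eqP => [<-|<-]; rewrite ?ord_predK ?ordSK.
    by case: eqP; rewrite // !phi0 !mulr0 addr0.
  case: ifP => imax; rewrite M1full fire_at imax ordmax0.
    split=> //; congr (full 0 _).
    by rewrite /wS addrC -at_ph_linear addrC -scalerDl val_desc ?X00 // w0_desc.
  rewrite scale0r addr0 stepL_desc; last first.
    by rewrite (allP bls) // mem_nth // ltn_neqAle -ltnS ltn_ord andbT -[p]/(val (@ord_max p)) val_eqE imax.
  split=> //; rewrite /= uok andbT.
  by rewrite mem_nth // ltn_neqAle -ltnS ltn_ord andbT -[p]/(val (@ord_max p)) val_eqE imax.
case: (absr rho ds) inv => [[i c] u] [-> _].
by rewrite /v /full !mul_row_col !mul0mx !add0r ouE outv_at.
Qed.
End Forms.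

(** * Codes of linear representations *)

Definition descr (q : rat) : algdesc := ([:: - q; 1], q, q).
(** The interval [[0, 1]] isolates the root of a linear polynomial just as well, and [q] then occurs
    only once in the description, so the machine has to encode it only once. *)
Definition descr01 (q : rat) : algdesc := ([:: - q; 1], 0, 1).

Lemma Poly_monic1 (q : rat) : Poly [:: - q; 1] = 'X - q%:P.
Proof. by rewrite /= !cons_poly_def mul0r add0r polyCN mul1r. Qed.

Lemma denotes_linear (R : realType) (q a b : rat) :
  a <= q <= b -> denotes ([:: - q; 1], a, b) (ratr q : R).
Proof.
move=> /andP[aq qb]; rewrite /denotes Poly_monic1; split.
- exact: monicXsubC.
- exact: irredp_XsubC.
- by rewrite rmorphB /= map_polyX map_polyC /= root_XsubC.
- by rewrite !ler_rat aq.
- by move=> y; rewrite rmorphB /= map_polyX map_polyC /= root_XsubC => /eqP.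
Qed.

Lemma denotes_descr (R : realType) (q : rat) : denotes (descr q) (ratr q : R).
Proof. by apply: denotes_linear; rewrite lexx. Qed.

Lemma denotes_descr01 (R : realType) (q : rat) :
  0 <= q <= 1 -> denotes (descr01 q) (ratr q : R).
Proof. exact: denotes_linear. Qed.

(* CodeSeq.code [:: a; b] *)
Definition code2 (a b : nat) : nat := (2 ^ a * (2 * 2 ^ b + 1))%N.

Lemma code_cons a l : CodeSeq.code (a :: l) = (2 ^ a * (2 * CodeSeq.code l + 1))%N.
Proof. by rewrite /= -muln2 mulnC addn1 mulnC [(_ * 2)%N]mulnC. Qed.

Lemma code2E a b : CodeSeq.code [:: a; b] = code2 a b.
Proof. by rewrite !code_cons /= /code2; lia. Qed.

Lemma pickle_pair (T1 T2 : countType) (x : T1) (y : T2) :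
  pickle (x, y) = code2 (pickle x) (pickle y).
Proof. exact: code2E. Qed.

Lemma pickle_Posz (n : nat) : pickle n%:Z = (3 * 2 ^ 2 ^ n)%N.
Proof.
have -> : pickle n%:Z = CodeSeq.code [:: CodeSeq.code [:: n]; 0%N] by [].
by rewrite code2E /code2 code_cons /= muln0 add0n muln1; lia.
Qed.

(** In lowest terms the fraction is the pair of -1 and [n], so only the denominator varies. *)
Lemma pickle_Ninv (n : nat) : (0 < n)%N ->
  pickle (- (n%:R^-1 : rat)) = code2 (pickle (-1 : int)) (3 * 2 ^ 2 ^ n).
Proof.
move=> n0.
have -> : - (n%:R^-1 : rat) = fracq (-1, n%:Z) by rewrite fracqE /= mulN1r.
have -> q : pickle q = pickle (valq q) by [].
rewrite [valq _]val_fracq /fracq_subdef /= eqz_nat -lt0n n0 gcd1n !divn1.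
by rewrite -pickle_Posz pickle_pair.
Qed.

Section Encoding.
(* the pickles of -1 : int, 0 : rat and 1 : rat, and of the description of 0, abstracted to keep
   these large unary numbers from being computed *)
Variables (kn k0 k1 kd : nat).

Definition descr_code (z : nat) : nat :=
  code2 (code2 (code2 z k1) k0) k1.

Definition inv_code (n : nat) : nat := descr_code (code2 kn (3 * 2 ^ 2 ^ n)).

Definition odd_exp (a : nat) : nat := (2 * 2 ^ a + 1)%N.

(** Started with [e = n] and [m = 1], each stage adds one layer of the encoding: two for the integer
    [n], one for the pair with numerator -1, and three for the leading coefficient 1 and the
    interval ends 0 and 1. *)
Definition inv_stages (m s : seq (nat * nat)) : seq stage :=
  [:: ([:: (1, 9)], [:: (1, 0)], [:: (1, 10)]);
      ([:: (3, 9)], [:: (1, 0)], [:: (1, 10)]);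
      ([:: (2 * 2 ^ kn, 9); (2 ^ kn, 0)], [:: (1, 0)], [:: (1, 10)]);
      ([:: (odd_exp k1, 9)], [:: (1, 0)], [:: (1, 10)]);
      ([:: (odd_exp k0, 9)], [:: (1, 0)], [:: (1, 10)]);
      ([:: (odd_exp k1, 9)], m, s)]%N.

(** The code is built from the inside out. First comes the list starting with [1 / y]; [s] keeps its
    code while that of [1 / y ^ 2] is computed; then follow the entry 0, the other matrices and the
    remaining components. *)
Definition chain : seq stage :=
  [:: ([:: (1, 3)], [:: (1, 0)], [::])]%N ++
  inv_stages [:: (2, 6); (1, 0)]%N [::] ++
  [:: ([:: (1, 4)], [:: (1, 0)], [:: (2, 9); (1, 0)])]%N ++
  inv_stages [:: (1, 10)]%N [::] ++
  [:: ([:: (2 * 2 ^ kd, 9); (2 ^ kd, 0)], [:: (2, 7); (1, 0)], [::]);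
      ([:: (1, 9)], [:: (2, 5)], [::])]%N.

Definition outf : nform := [:: (1, 9); (1, 5)]%N.

Definition rep_code (A T U : nat) : nat :=
  code2 A (2 ^ (2 ^ kd * (2 * (2 ^ inv_code (y2v A T U) *
    (2 * (2 ^ inv_code (yv A T U) * (2 * T + 1)) + 1)) + 1)) * (2 * U + 1)).

Lemma nxtE A T U e m s (fe fm fs : seq (nat * nat)) :
  nxt A T U (e, m, s) (fe, fm, fs) =
  let x := env A T U (m * 2 ^ e) s in (nev fe x, nev fm x, nev fs x).
Proof. by []. Qed.

Lemma nev_cons c i l x : nev ((c, i) :: l) x = (c * x i + nev l x)%N.
Proof. by []. Qed.

Lemma nev_nil x : nev [::] x = 0%N.
Proof. by []. Qed.

Lemma env0 A T U m s : env A T U m s 0 = 1%N. Proof. by []. Qed.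
Lemma env3 A T U m s : env A T U m s 3 = yv A T U. Proof. by []. Qed.
Lemma env4 A T U m s : env A T U m s 4 = y2v A T U. Proof. by []. Qed.
Lemma env5 A T U m s : env A T U m s 5 = (2 ^ A)%N. Proof. by []. Qed.
Lemma env6 A T U m s : env A T U m s 6 = T. Proof. by []. Qed.
Lemma env7 A T U m s : env A T U m s 7 = U. Proof. by []. Qed.
Lemma env9 A T U m s : env A T U m s 9 = m. Proof. by []. Qed.
Lemma env10 A T U m s : env A T U m s 10 = s. Proof. by []. Qed.
Definition nevE :=
  (nev_cons, nev_nil, env0, env3, env4, env5, env6, env7, env9, env10).

(** [E] may stay unspecified, because the forms later supplied for [m'] and [s'] do not read
    coordinate 9. *)
Lemma foldl_inv_stages A T U n s m' s' :
  exists E, foldl (nxt A T U) (n, 1, s)%N (inv_stages m' s') =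
  let x := env A T U E s in (inv_code n, nev m' x, nev s' x).
Proof.
rewrite /inv_stages; cbn [foldl].
do 6! (rewrite nxtE; cbv zeta; rewrite ?nevE ?addn0 ?mul1n ?muln1).

eexists; do 2! congr pair.
rewrite /inv_code /descr_code /code2 /odd_exp.
have -> : (2 * 2 ^ kn * 2 ^ (3 * 2 ^ 2 ^ n) + 2 ^ kn = 2 ^ kn * (2 * 2 ^ (3 * 2 ^ 2 ^ n) + 1))%N by nia.
rewrite mulnC; congr (2 ^ _ * _)%N; rewrite mulnC; congr (2 ^ _ * _)%N.
exact: mulnC.
Qed.

Lemma cval_chain A T U : cval chain outf A T U = rep_code A T U.
Proof.
rewrite /cval /vals take_size /chain !foldl_cat; cbn [foldl].
rewrite nxtE; cbv zeta; rewrite !nevE !addn0 !mul1n.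
have [E ->] := foldl_inv_stages A T U (yv A T U) 0 [:: (2, 6); (1, 0)]%N [::].
cbv zeta; rewrite nxtE; cbv zeta; rewrite !nevE !addn0 !mul1n.
set s1 := (2 * _ + 1)%N.
have [E' ->] := foldl_inv_stages A T U (y2v A T U) s1 [:: (1, 10)]%N [::].
cbv zeta; rewrite !nxtE; cbv zeta; cbn [fst snd]; rewrite !nevE !addn0 !mul1n.
rewrite /rep_code.
have -> : (2 ^ kd * (2 * (2 ^ inv_code (y2v A T U) *
    (2 * (2 ^ inv_code (yv A T U) * (2 * T + 1)) + 1)) + 1) =
  2 * 2 ^ kd * (s1 * 2 ^ inv_code (y2v A T U)) + 2 ^ kd)%N by rewrite /s1; nia.
rewrite muln1 /code2 mulnDr muln1 [(2 ^ A * (2 * _))%N]mulnA [(2 ^ A * 2)%N]mulnC.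
by congr (_ * 2 ^ _ + _)%N; apply: mulnC.
Qed.

Lemma chain_ok : all okst chain.
Proof. by []. Qed.

Lemma outf_ok : okf outf.
Proof. by []. Qed.

End Encoding.

Definition kneg : nat := pickle (-1 : int).
Definition kzero : nat := pickle (0 : rat).
Definition kone : nat := pickle (1 : rat).
Definition kdescr0 : nat := pickle (descr 0).

Lemma pickle_descr01_inv (n : nat) : (0 < n)%N ->
  pickle (descr01 n%:R^-1) = inv_code kneg kzero kone n.
Proof.
move=> n0; rewrite /descr01 !pickle_pair.
have -> : pickle [:: - (n%:R^-1 : rat); 1] =
  code2 (pickle (- (n%:R^-1 : rat))) (pickle (1 : rat)) by exact: code2E.
by rewrite pickle_Ninv.
Qed.

Lemma pickle_cons (T1 : countType) (x : T1) s :
  pickle (x :: s) = (2 ^ pickle x * (2 * pickle s + 1))%N.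
Proof. exact: code_cons. Qed.

Lemma y2v_sqr A T U : y2v A T U = (yv A T U ^ 2)%N.
Proof. by rewrite /y2v /yv !expnMn -!expnM ![(_ * 2)%N]mulnC !expnM. Qed.

Lemma yv_gt0 A T U : (0 < yv A T U)%N.
Proof. by rewrite /yv !muln_gt0 !expn_gt0. Qed.

(** Unique factorization: comparing [y] alone compares all three guesses. *)
Lemma yv_inj A T U A' T' U' : yv A T U = yv A' T' U' ->
  [/\ A = A', T = T' & U = U'].
Proof.
have lg p : prime p -> logn p (yv A T U) = (A * logn p 2 + T * logn p 3 + U * logn p 5)%N.
  by move=> pp; rewrite /yv !lognM ?muln_gt0 ?expn_gt0 // !lognX.
move=> E; have lg' p : prime p -> logn p (yv A T U) = (A' * logn p 2 + T' * logn p 3 + U' * logn p 5)%N.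
  by move=> pp; rewrite E /yv !lognM ?muln_gt0 ?expn_gt0 // !lognX.
have H p (pp : prime p) := etrans (esym (lg p pp)) (lg' p pp).
by split; [have := H 2%N isT | have := H 3%N isT | have := H 5%N isT];
  rewrite !logn_prime //= !muln1 !muln0 ?addn0 ?add0n.
Qed.

Lemma pickle_first_row (T1 T2 : countType) (a : T1) (x0 x1 x2 : T2) l ls :
  pickle (a, (x0 :: x1 :: x2 :: l) :: ls) =
  code2 (pickle a) (2 ^ (2 ^ pickle x0 * (2 * (2 ^ pickle x1 *
    (2 * (2 ^ pickle x2 * (2 * pickle l + 1)) + 1)) + 1)) * (2 * pickle ls + 1)).
Proof. by rewrite pickle_pair !pickle_cons. Qed.

(* the code of a representation whose first matrix starts with the row (0, 1/y^2, 1/y, ...),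
   where y itself is made from the rest of the representation *)
Lemma pickle_lrep (r : nat) (dv dw l : seq algdesc) (dMs : seq (seq algdesc)) :
  let A := pickle (r, dv, dw) in let T := pickle l in let U := pickle dMs in
  let y := yv A T U in
  pickle ((r, dv, dw,
     (descr 0 :: descr01 (y ^ 2)%:R^-1 :: descr01 y%:R^-1 :: l) :: dMs) : lrep_code) =
  rep_code kneg kzero kone kdescr0 A T U.
Proof.
move=> A T U y; apply: etrans (pickle_first_row _ _ _ _ _ _ _ _) _.
rewrite -[pickle (r, dv, dw)]/A -[pickle l]/T -[pickle dMs]/U -[pickle (descr 0)]/kdescr0.
have y0 : (0 < y)%N by apply: yv_gt0.
have y20 : (0 < y ^ 2)%N by rewrite expn_gt0 y0.
by rewrite (pickle_descr01_inv _ y0) (pickle_descr01_inv _ y20) /rep_code y2v_sqr.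
Qed.

(** * Bounds on the block values *)

Lemma all_bound (T : eqType) (P : nat -> T -> bool) :
  (forall x n m, (n <= m)%N -> P n x -> P m x) -> (forall x, exists n, P n x) ->
  forall s, exists n, forall m, (n <= m)%N -> all (P m) s.
Proof.
move=> mono ex; elim=> [|x s [n nP]]; first by exists 0%N.
have [n' n'P] := ex x; exists (maxn n n') => m; rewrite geq_max => /andP[nm n'm] /=.
by rewrite (mono _ _ _ n'm) // nP.
Qed.

Lemma all_bound1 (T : eqType) (P : nat -> T -> bool) :
  (forall x n m, (n <= m)%N -> P n x -> P m x) -> (forall x, exists n, P n x) ->
  forall s, exists n, all (P n) s.
Proof. by move=> mono ex s; have [n nP] := all_bound _ _ mono ex s; exists n; apply: nP. Qed.

Lemma bdf_mono l n m : (n <= m)%N -> bdf n l -> bdf m l.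
Proof. by move=> nm; apply: sub_all => q; rewrite !ltnS => /leq_trans; apply. Qed.

Lemma bdf_ex l : exists n, bdf n l.
Proof.
apply: (all_bound1 _ (fun n (q : int * nat) => q.2 < n.+1)%N) => [q n m nm|q].
  by rewrite !ltnS => /leq_trans; apply.
by exists q.2; rewrite ltnSn.
Qed.

Lemma bdl_ex (ls : seq letter) : exists n, (3 <= n)%N && all (bdl n) ls.
Proof.
have mono (a : letter) n m : (n <= m)%N -> bdl n a -> bdl m a.
  move=> nm /andP[a1 a2]; apply/andP; split.
    by apply: sub_all a1 => l; apply: bdf_mono.
  by apply: sub_all a2 => q; apply: bdf_mono.
have ex (a : letter) : exists n, bdl n a.
  have [n1 h1] := all_bound1 _ bdf (fun x n m => bdf_mono x n m) bdf_ex a.1.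
  have [n2 h2] := all_bound1 _ (fun n (q : nat * lform) => bdf n q.2)
    (fun q n m => bdf_mono q.2 n m) (fun q => bdf_ex q.2) a.2.
  exists (maxn n1 n2); apply/andP; split.
    by apply: sub_all h1 => l; apply/bdf_mono/leq_maxl.
  by apply: sub_all h2 => l; apply/bdf_mono/leq_maxr.
have [n nP] := all_bound _ _ mono ex ls.
by exists (maxn 3 n); rewrite leq_maxl nP ?leq_maxr.
Qed.

Definition wt (l : lform) : nat := foldr (fun q s => `|q.1| + s)%N 0%N l.
Definition light (B : nat) (a : letter) : bool :=
  [&& all (fun l => wt l <= B)%N a.1, (size a.1 <= B)%N &
      all (fun q => wt q.2 <= B)%N a.2].

Lemma light_ex (ls : seq letter) : exists B, (2 <= B)%N && all (light B) ls.
Proof.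
have mono (a : letter) n m : (n <= m)%N -> light n a -> light m a.
  move=> nm /and3P[a1 a2 a3]; apply/and3P; split; last 2 first.
  - exact: leq_trans nm.
  - by apply: sub_all a3 => q /leq_trans; apply.
  - by apply: sub_all a1 => q /leq_trans; apply.
have wmono (l : lform) n m : (n <= m)%N -> (wt l <= n)%N -> (wt l <= m)%N.
  by move=> nm /leq_trans; apply.
have wex (l : lform) : exists n, (wt l <= n)%N by exists (wt l).
have ex (a : letter) : exists n, light n a.
  have [n1 h1] := all_bound _ (fun n l => wt l <= n)%N wmono wex a.1.
  have [n2 h2] := all_bound _ (fun n (q : nat * lform) => wt q.2 <= n)%N
    (fun q => wmono q.2) (fun q => wex q.2) a.2.
  exists (maxn (maxn n1 n2) (size a.1)); apply/and3P; split.
  - by apply: h1; rewrite -maxnA leq_maxl.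
  - exact: leq_maxr.
  - by apply: h2; rewrite [maxn n1 n2]maxnC -maxnA leq_maxl.
have [n nP] := all_bound _ _ mono ex ls.
by exists (maxn 2 n); rewrite leq_maxl nP ?leq_maxr.
Qed.

Lemma ev_bound l X M : (forall i, `|X i| <= M) -> `|ev l X| <= (wt l)%:Z * M.
Proof.
move=> XM; elim: l => [|q l IH] /=; first by rewrite normr0 mul0r.
apply: le_trans (ler_normD _ _) _; rewrite PoszD mulrDl lerD // normrM abszE.
by rewrite ler_wpM2l.
Qed.

Lemma upd_bound B a X M : light B a -> (0 < B)%N -> (forall i, `|X i| <= M) ->
  forall i, `|upd a.2 X i| <= B%:Z * M.
Proof.
move=> /and3P[_ _ a3] B0 XM i; have M0 : 0 <= M by apply: le_trans (XM 0%N).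
rewrite /upd; elim: a.2 a3 => [_|q s IH /andP[qB /IH{}IH]] /=.
  by apply: le_trans (XM i) _; rewrite ler_peMl // lez_nat.
case: eqP => // _; apply: le_trans (ev_bound _ _ _ XM) _.
by rewrite ler_wpM2r // lez_nat.
Qed.

Lemma sem_bound B ls X0 u : (0 < B)%N -> all (light B) ls -> all (mem ls) u ->
  (forall i, `|X0 i| <= 1) -> forall i, `|sem X0 u i| <= (B ^ size u)%:Z.
Proof.
move=> B0 lB ul X1; elim: u ul => [_|a u IH /andP[al /IH{}IH]] /=; first exact: X1.
move=> i; rewrite expnS PoszM; apply: upd_bound => //.
exact: (allP lB).
Qed.

(** A letter adds at most [B] squares, each at most [(B * b) ^ 2] with [b = B ^ size u]. The
    induction closes by [b ^ 4 + B ^ 3 * b ^ 2 <= B ^ 4 * b ^ 4], which uses [B >= 2]. *)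
Lemma pen_bound B ls X0 u : (1 < B)%N -> all (light B) ls -> all (mem ls) u ->
  (forall i, `|X0 i| <= 1) -> pen X0 u <= ((B ^ 4) ^ size u)%:Z.
Proof.
move=> B1 lB ul X1; have B0 := ltnW B1.
elim: u ul => [_|a u IH] //= /andP[al ul].
have /and3P[c1 c2 _] : light B a by apply: (allP lB).
have sq : \sum_(l <- a.1) (ev l (sem X0 u)) ^+ 2 <= (B * (B * B ^ size u) ^ 2)%:Z.
  apply: (@le_trans _ _ (\sum_(l <- a.1) ((B * B ^ size u) ^ 2)%:Z)).
    rewrite big_seq [X in _ <= X]big_seq; apply: ler_sum => l la.
    rewrite -real_normK ?num_real //.
    rewrite (_ : ((B * B ^ size u) ^ 2)%:Z = (B * B ^ size u)%:Z ^+ 2); last first.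
      by rewrite expnS expn1 PoszM expr2.
    rewrite lerXn2r ?nnegrE //.
    apply: le_trans (ev_bound _ _ _ (sem_bound _ _ _ _ B0 lB ul X1)) _.
    by rewrite PoszM ler_wpM2r // lez_nat (allP c1).
  rewrite big_const_seq count_predT iter_addr_0 -mulr_natr natz -PoszM lez_nat.
  by rewrite mulnC leq_mul2r c2 orbT.
apply: le_trans (lerD (IH ul) sq) _.
rewrite -PoszD lez_nat [((B ^ 4) ^ _.+1)%N]expnS.
set b := (B ^ size u)%N.
have -> : ((B ^ 4) ^ size u = b ^ 4)%N by rewrite -!expnM mulnC.
have b1 : (0 < b)%N by rewrite expn_gt0 B0.
have h1 : (b ^ 2 <= b ^ 4)%N by rewrite leq_pexp2l.
have h2 : (B ^ 3 + 1 <= B ^ 4)%N.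
  by rewrite addn1 ltn_exp2l.
rewrite (_ : B * (B * b) ^ 2 = B ^ 3 * b ^ 2)%N; last by rewrite expnMn mulnA -expnS.
apply: (@leq_trans ((B ^ 3 + 1) * b ^ 4)%N); last by rewrite leq_mul2r h2 orbT.
by rewrite mulnDl mul1n addnC leq_add2r leq_mul2l h1 orbT.
Qed.

Section Values.
Variables (ls : seq letter) (X0 : nat -> int) (B y : nat).
Hypotheses (B1 : (1 < B)%N) (lB : all (light B) ls) (X01 : forall i, `|X0 i| <= 1).
Hypothesis y0 : (0 < y)%N.

(** [delta] cancels the growth rate of [pen_bound]. After this scaling the three subtracted terms
    are at most 4, 1 and 4, so [kappa = 1 / 10] keeps the value of a block at least [1 / 10]. *)
Definition delta : rat := ((B ^ 4)%:R)^-1.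
Definition kappa : rat := 10^-1.
Definition rho : rat := y%:R^-1.
Local Notation g := (gval X0 delta kappa rho).

Definition accepting (u : seq letter) : Prop :=
  [/\ pen X0 u = 0, sem X0 u 3%N = y%:Z & sem X0 u 1%N = -1].

Lemma delta_gt0 : 0 < delta.
Proof. by rewrite invr_gt0 ltr0n expn_gt0 (ltnW B1). Qed.

Lemma rho_gt0 : 0 < rho.
Proof. by rewrite invr_gt0 ltr0n. Qed.

Lemma rho_le1 : rho <= 1.
Proof. by rewrite invf_le1 ?ltr0n // ler1n. Qed.

Lemma gval_accepting u : accepting u -> 1 < g u.
Proof.
case=> p0 s3 s1; rewrite /gval p0 s3 s1 addNr divff ?pnatr_eq0 -?lt0n //.
rewrite subrr expr0n /= !subr0 ltrDl !mulr_gt0 ?exprn_gt0 ?delta_gt0 ?rho_gt0 //.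
Qed.

(** By integrality, a failed check or a wrong final counter costs at least 1, hence at least
    [rho ^+ 2]; a wrong [y_u] costs [(y_u - y)^2 rho^2], again at least [rho ^+ 2]. *)
Lemma gval_le1 u : ~ accepting u -> g u <= 1.
Proof.
clear lB => na; rewrite /gval -[leRHS]addr0 lerD2l pmulr_rle0; last first.
  by rewrite mulr_gt0 ?exprn_gt0 ?delta_gt0.
have p0 := pen_ge0 X0 u.
have [pz|pn] := eqVneq (pen X0 u) 0; last first.
  have p1 : 1 <= (pen X0 u)%:~R :> rat by rewrite ler1z; lia.
  have r1 : rho ^+ 2 <= 1 by rewrite expr_le1 ?rho_le1 // ltW ?rho_gt0.
  have := sqr_ge0 ((sem X0 u 3%N)%:~R * rho - 1); have := sqr_ge0 ((sem X0 u 1%N + 1)%:~R : rat).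
  by lra.
have [sz|sn] := eqVneq (sem X0 u 1%N) (-1); last first.
  have p1 : 1 <= (sem X0 u 1%N + 1)%:~R ^+ 2 :> rat.
    by rewrite -rmorphXn /= ler1z; nia.
  have r1 : rho ^+ 2 <= 1 by rewrite expr_le1 ?rho_le1 // ltW ?rho_gt0.
  have := sqr_ge0 ((sem X0 u 3%N)%:~R * rho - 1).
  by rewrite pz; lra.
have yn : sem X0 u 3%N - y%:Z != 0 by rewrite subr_eq0; apply/eqP => E; apply: na.
have -> : (sem X0 u 3%N)%:~R * rho - 1 = (sem X0 u 3%N - y%:Z)%:~R * rho.
  by rewrite rmorphB mulrBl /= divff // pnatr_eq0 -lt0n.
rewrite exprMn pz sz.
have : 1 <= (sem X0 u 3%N - y%:Z)%:~R ^+ 2 :> rat by rewrite -rmorphXn /= ler1z; nia.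
have : 0 < rho ^+ 2 by rewrite exprn_gt0 ?rho_gt0.
rewrite addNr mulr0z expr0n /= !subr0; nra.
Qed.

Lemma gval_gt0 u : all (mem ls) u -> 0 < g u.
Proof.
move=> ul; rewrite /gval.
have B0 := ltnW B1; set b : rat := (B ^ size u)%:R.
have b1 : 1 <= b by rewrite ler1n expn_gt0 B0.
have sb i : `|(sem X0 u i)%:~R| <= b.
  by rewrite -intr_norm /b pmulrn ler_int (sem_bound _ _ _ _ B0 lB ul X01).
have pb : (pen X0 u)%:~R <= b ^+ 4.
  have -> : b ^+ 4 = ((B ^ 4) ^ size u)%:Z%:~R by rewrite -pmulrn /b -natrX -!expnM mulnC.
  by rewrite ler_int (pen_bound _ _ _ _ B1 lB ul X01).
have -> : delta ^+ size u = (b ^+ 4)^-1.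
  by rewrite /delta exprVn -natrX /b -natrX -!expnM mulnC.
have r0 := rho_gt0; have r1 := rho_le1.
have b2 : b ^+ 2 <= b ^+ 4 by rewrite ler_weXn2l.
have b4 : 0 < b ^+ 4 by rewrite exprn_gt0 // (lt_le_trans ltr01).
have h3 : ((sem X0 u 3%N)%:~R * rho - 1) ^+ 2 <= 4 * b ^+ 4.
  have : `|(sem X0 u 3%N)%:~R * rho - 1| <= 2 * b.
    apply: le_trans (ler_normB _ _) _; rewrite normrM normr1 (ger0_norm (ltW r0)).
    have : `|(sem X0 u 3)%:~R| * rho <= b * 1 by rewrite ler_pM // ltW.
    by lra.
  by rewrite ler_norml => /andP[]; nra.
have h1 : (sem X0 u 1%N + 1)%:~R ^+ 2 <= 4 * b ^+ 4.
  have : `|(sem X0 u 1%N + 1)%:~R| <= 2 * b.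
    rewrite rmorphD /=; apply: le_trans (ler_normD _ _) _.
    by rewrite normr1; have := sb 1%N; lra.
  by rewrite ler_norml => /andP[]; nra.
have : -(9 * b ^+ 4) <= rho ^+ 2 - ((sem X0 u 3)%:~R * rho - 1) ^+ 2 -
     (pen X0 u)%:~R - (sem X0 u 1%N + 1)%:~R ^+ 2.
  by have := sqr_ge0 rho; lra.
have kb : 0 <= kappa * (b ^+ 4)^-1 by rewrite mulr_ge0 ?invr_ge0 // ltW.
move=> /(ler_wpM2l kb).
have -> : kappa * (b ^+ 4)^-1 * - (9 * b ^+ 4) = - (9 / 10).
  by rewrite /kappa; field; rewrite gt_eqF // (lt_le_trans ltr01).
by lra.
Qed.

End Values.

(** * Digits and growth *)

Section Blocks.
Variables (ls : seq letter) (X0 : nat -> int) (delta kap rho : rat).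
Hypothesis ls_gt0 : (0 < size ls)%N.
Local Notation p := (size ls).
Local Notation g := (gval X0 delta kap rho).
Local Notation absr := (absr ls X0 delta kap rho).

Lemma ph_lt (i : 'I_p.+1) : i != ord_max -> (i < p)%N.
Proof. by move=> im; rewrite ltn_neqAle -ltnS ltn_ord andbT. Qed.

Lemma absr_le1 : (forall u, all (mem ls) u -> `|g u| <= 1) ->
  forall ds, `|(absr ds).1.2| <= 1.
Proof.
move=> g1 ds.
suff : let: (i, c, u) := absr ds in `|c| <= 1 /\ all (mem ls) u.
  by case: (absr ds) => [[i c] u] [].
elim: ds => [|d ds IH] /=; first by rewrite normr1.
case: (absr ds) IH => [[i c] u] [c1 ul]; case: eqP => // _.
case: eqP => [_|/eqP/ph_lt im]; last by rewrite /= mem_nth.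
by rewrite normrM mulr_ile1 // g1.
Qed.

(** Least significant digit first, so this is [0^i 1] in reading order. *)
Definition code_letter (i : nat) : seq nat := 1%N :: nseq i 0%N.

Lemma absr_nseq i ds c u : (i <= p)%N -> absr ds = (ord0, c, u) ->
  absr (nseq i 0%N ++ ds) = (inord i, c, u).
Proof.
move=> ip E; elim: i ip => [|i IH] ip /=.
  by rewrite E; congr (_, _, _); apply: val_inj; rewrite /= inordK.
rewrite (IH (ltnW ip)); congr (_, _, _); apply: val_inj => /=.
by rewrite !inordK ?modn_small // ltnW.
Qed.

Lemma absr_letter i ds c u : (i < p)%N -> absr ds = (ord0, c, u) ->
  absr (code_letter i ++ ds) = (ord0, c, nth Ltick ls i :: u).
Proof.
move=> ip E; rewrite /= (absr_nseq _ _ _ _ (ltnW ip) E) /=.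
by rewrite -val_eqE /= inordK ?ltn_eqF // ltnS ltnW.
Qed.

Lemma absr_sep ds c u : absr ds = (ord0, c, u) ->
  absr (code_letter p ++ ds) = (ord0, c * g u, [::]).
Proof.
move=> E; rewrite /= (absr_nseq _ _ _ _ (leqnn _) E) /=.
by rewrite -val_eqE /= inordK // eqxx.
Qed.

Definition code_word (u : seq letter) : seq nat :=
  flatten [seq code_letter (index a ls) | a <- u].

Lemma absr_word u ds c : all (mem ls) u -> absr ds = (ord0, c, [::]) ->
  absr (code_word u ++ ds) = (ord0, c, u).
Proof.
move=> ul E; elim: u ul => [//|a u IH] /andP[al /IH{}IH].
rewrite (_ : code_word (a :: u) = code_letter (index a ls) ++ code_word u) // -catA.
by rewrite (absr_letter _ _ _ _ _ IH) ?index_mem // nth_index.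
Qed.

Definition code_block (u : seq letter) : seq nat := code_letter p ++ code_word u.

Lemma absr_block u ds c : all (mem ls) u -> absr ds = (ord0, c, [::]) ->
  absr (code_block u ++ ds) = (ord0, c * g u, [::]).
Proof. by move=> ul E; rewrite -catA; apply: absr_sep; apply: absr_word. Qed.

(* the leading digit of a positive number is nonzero, so every word starts with the letter of
   index 0 *)
Definition code_power (u : seq letter) (m : nat) : seq nat :=
  iter m (cat (code_block u)) (code_letter p ++ [:: 1%N]).

Lemma absr_power u m : all (mem ls) u ->
  absr (code_power u m) = (ord0, g [:: nth Ltick ls 0] * g u ^+ m, [::]).
Proof.
move=> ul; elim: m => [|m IH]; last first.
  by rewrite /code_power iterS (absr_block _ _ _ ul IH) exprSr mulrA.
rewrite /code_power (absr_sep _ 1 [:: nth Ltick ls 0]) ?mul1r ?mulr1 //=.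
by rewrite -val_eqE /= ltn_eqF.
Qed.

Lemma size_power u m :
  size (code_power u m) = (m * size (code_block u) + p.+2)%N.
Proof.
elim: m => [|m IH]; first by rewrite /code_power size_cat /= size_nseq addn1.
by rewrite /code_power iterS size_cat [size (iter _ _ _)]IH mulSn addnA.
Qed.

Lemma power_le1 u m : all (fun d => d <= 1)%N (code_power u m).
Proof.
have le1 i : all (fun d => d <= 1)%N (code_letter i) by rewrite /= all_nseq orbT.
elim: m => [|m IH]; first by rewrite /code_power all_cat le1.
rewrite /code_power iterS all_cat [all _ (iter _ _ _)]IH /code_block all_cat le1.
by rewrite /code_word /= andbT; elim: u {IH} => //= a u IH; rewrite all_cat all_nseq orbT.
Qed.

Lemma last_power u m : last 0%N (code_power u m) = 1%N.
Proof.
elim: m => [|m IH]; first by rewrite /code_power last_cat.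
rewrite /code_power iterS last_cat -/(code_power u m).
have : (0 < size (code_power u m))%N by rewrite size_power addnS.
by case: (code_power u m) IH.
Qed.

End Blocks.

Lemma digits_fuelE k n f f' : (1 < k)%N -> (n <= f)%N -> (n <= f')%N ->
  digits_fuel k f n = digits_fuel k f' n.
Proof.
move=> k1; elim: f f' n => [|f IH] [|f'] n //=; rewrite ?leqn0.
- by move=> /eqP-> _.
- by move=> _ /eqP->.
move=> nf nf'; case: eqP => // /eqP n0; congr cons.
have lt : (n %/ k < n)%N by rewrite ltn_Pdiv // lt0n.
by apply: IH; rewrite -ltnS (leq_trans lt).
Qed.

(** Crude, but it shows that numbers with many digits are large, as [exp_growth] requires. *)
Lemma size_digits k n : (size (digits k n) <= n)%N.
Proof.
rewrite /digits; move: {1 3}n => f; elim: f n => [|f IH] n //=.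
by case: eqP => //= _; rewrite ltnS.
Qed.

(** The last entry is the leading digit; the default 1 admits the empty list, which represents 0. *)
Lemma digits_surj k ds : (1 < k)%N -> all (fun d => d < k)%N ds -> last 1%N ds != 0%N ->
  exists n, digits k n = ds /\ (n < k ^ size ds)%N.
Proof.
move=> k1; have k0 := ltnW k1; elim: ds => [|d ds IH] /=; first by exists 0%N.
case/andP=> dk dsk ls.
have [|n [nE nlt]] := IH dsk; first by case: ds ls {IH dsk}.
exists (n * k + d)%N; split; last first.
  by rewrite expnSr (@leq_trans (n.+1 * k)) // ?leq_mul2r ?nlt ?orbT // mulSn addnC ltn_add2r.
have nd0 : (0 < n * k + d)%N.
  rewrite addn_gt0 muln_gt0 k0 andbT; case: (posnP n) nE => //= n0 /esym.
  by rewrite n0 /digits /= => dE; rewrite dE /= in ls; rewrite lt0n.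
rewrite /digits -{1}(prednK nd0) /= (gtn_eqF nd0) modnMDl modn_small //.
rewrite divnMDl // divn_small // addn0; congr cons; rewrite -nE /digits.
apply: digits_fuelE => //; rewrite -ltnS prednK //.
case: (posnP n) nd0 => [->//|n0 _].
by rewrite (leq_trans _ (leq_addr _ _)) // ltn_Pmulr.
Qed.

Lemma powR_expn (R : realType) (k e : nat) (s : R) :
  powR ((k ^ e)%:R) s = powR k%:R s ^+ e.
Proof.
by rewrite natrX -!powR_mulrn ?powR_ge0 ?ler0n // -!powRrM mulrC.
Qed.

Lemma bounded_no_growth (R : realType) (f : nat -> R) :
  (forall n, `|f n| <= 1) -> ~ poly_growth f.
Proof.
(* The threshold 1 avoids [n = 0], where the power is 0. *)
move=> f1 [s [s0 []]]; exists 1%N, 1; split=> // n n1; rewrite mul1r.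
apply: le_trans (f1 n) _.
have : powR 1 s <= powR n%:R s by rewrite ge0_ler_powR ?nnegrE ?ler1n ?ler0n // ltW.
by rewrite powR1.
Qed.

(** With [b = k ^ s], the exponent [s] is chosen so that [b ^+ (L * 2) = G]. Then [f a] is [c] times
    the power of [b] with exponent [2 * L * m], while [a ^ s] is at most that with exponent
    [m * L + L0]; so the quotient is unbounded. *)
Lemma exp_growth (R : realType) (f : nat -> R) (k L L0 : nat) (c G : R) :
  (1 < k)%N -> (0 < L)%N -> 0 < c -> 1 < G ->
  (forall m, exists a, [/\ (m <= a)%N, (a <= k ^ (m * L + L0))%N & f a = c * G ^+ m]) ->
  poly_growth f.
Proof.
move=> k1 L1 c0 G1 aE; have G0 : 0 < G by apply: lt_trans G1.
have lk : 0 < ln (k%:R : R) by rewrite ln_gt0 // ltr1n.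
pose s := ln G / (ln k%:R * (2 * L)%:R); exists s.
have L0R : 0 < (2 * L)%:R :> R by rewrite ltr0n muln_gt0.
have s0 : 0 < s by apply: divr_gt0; [exact: ln_gt0 | exact: mulr_gt0].
split=> // -[n0 [C [C0 bd]]]; pose b := powR k%:R s : R.
have b0 : 0 < b by rewrite powR_gt0 // ltr0n ltnW.
have bG : b ^+ (L * 2) = G.
  have kR : 0 < k%:R :> R by rewrite ltr0n ltnW.
  apply: ln_inj; rewrite ?posrE ?exprn_gt0 //.
  rewrite -powR_mulrn ?powR_ge0 // /b -powRrM ln_powR mulnC /s; field.
  by rewrite !gt_eqF // ltr0n.
have b1 : 1 < b.
  have : 1 < b ^+ (L * 2) by rewrite bG.
  by rewrite expr_gt1 ?ltW // muln_gt0 L1.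
have key m : (n0 <= m)%N -> c * b ^+ (m * L) <= C * b ^+ L0.
  move=> n0m; have [a [ma am fE]] := aE m.
  have := bd a (leq_trans n0m ma); rewrite fE ger0_norm; last first.
    by rewrite mulr_ge0 ?exprn_ge0 // ltW.
  move=> h; have {}h : c * G ^+ m <= C * b ^+ (m * L + L0).
    apply: le_trans h _; rewrite ler_pM2l // -powR_expn.
    by rewrite ge0_ler_powR ?nnegrE ?ler0n ?ler_nat // ltW.
  move: h; rewrite -bG -exprM (_ : L * 2 * m = m * L + m * L)%N; last by lia.
  by rewrite !exprD mulrA [b ^+ (m * L) * b ^+ L0]mulrC mulrA ler_pM2r // exprn_gt0.
have bern m : 1 + (b - 1) *+ m <= b ^+ m.
  elim: m => [|m IH]; first by rewrite mulr0n addr0.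
  rewrite exprS; apply: (@le_trans _ _ (b * (1 + (b - 1) *+ m))); last by rewrite ler_pM2l.
  rewrite mulrS -[(b - 1) *+ m]mulr_natr.
  have : 0 <= (b - 1) * (b - 1) * m%:R by rewrite -expr2 mulr_ge0 ?sqr_ge0 ?ler0n.
  by lra.
(* For [N > x] and [m = n0 + N], the Bernoulli bound exceeds [C * b ^+ L0 / c], against [key]. *)
pose x := C * b ^+ L0 / c / (b - 1).
have [N xN] : exists N : nat, x < N%:R.
  by exists (Num.bound `|x|); apply: le_lt_trans (ler_norm _) (archi_boundP (normr_ge0 _)) .
have := key (n0 + N)%N (leq_addr _ _).
rewrite -ler_pdivlMl // mulrC leNgt => /negP; apply.
have bm : b ^+ (n0 + N) <= b ^+ ((n0 + N) * L) by rewrite ler_weXn2l ?ltW // leq_pmulr.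
apply: lt_le_trans bm; apply: lt_le_trans (bern _).
have : x * (b - 1) < N%:R * (b - 1) by rewrite ltr_pM2r ?subr_gt0.
rewrite /x divfK ?subr_eq0 ?gt_eqF // => h; apply: lt_le_trans h _.
rewrite mulrnDr -mulr_natl; have : 0 <= (b - 1) *+ n0 by rewrite mulrn_wge0 // subr_ge0 ltW.
by lra.
Qed.

(** * The reduction *)

Lemma run_det D f f' st r r' :
  run D f st = Some r -> run D f' st = Some r' -> r = r'.
Proof.
elim: f f' st => [|f IH] f' st.
  by rewrite {1}/run; case: ifP => // sp [<-]; case: f' => [|f']; rewrite /run sp => -[].
case: (leqP (size D) st.1) => sp.
  by rewrite /run sp => -[<-]; case: f' => [|f']; rewrite /run sp => -[].
case E: (step D st) => [st'|]; last by cbn [run]; rewrite leqNgt sp E.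
rewrite (run_step _ _ _ _ sp E); case: f' => [|f'].
  by move=> _; cbn [run]; rewrite leqNgt sp.
by rewrite (run_step _ _ _ _ sp E); apply: IH.
Qed.

Lemma halts_with_det D c a b : halts_with D c a -> halts_with D c b -> a = b.
Proof.
by move=> [f [st [rf <-]]] [f' [st' [rf' <-]]]; rewrite (run_det _ _ _ _ _ _ rf rf').
Qed.

(** No letter assigns coordinate 0, so the constant 1 survives every word, legal or not. *)
Lemma lets_target D ch out a : a \in lets D ch out -> all (fun q => q.1 != 0%N) a.2.
Proof.
move: a; apply/(@allP _ (fun a : letter => all (fun q => q.1 != 0%N) a.2)).
rewrite /lets !all_cat; apply/and3P; split=> //.
  by apply/allP => b /mapP[i _ ->].
apply/allP=> b /flattenP[l /mapP[p _ ->]]; rewrite /Dlets.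
by case: nth => [r|r j]; rewrite !inE; [move/eqP=> -> | case/orP=> /eqP->].
Qed.

Lemma sem_const D ch out u : all (mem (lets D ch out)) u -> sem Xinit u 0%N = 1.
Proof.
elim: u => // a u IH /andP[/lets_target ta /IH <-] /=.
by rewrite /upd; elim: a.2 ta => //= q s IHs /andP[q0 /IHs->]; rewrite eq_sym (negPf q0).
Qed.

Lemma Xinit_le1 i : `|Xinit i| <= 1.
Proof. by rewrite /Xinit; case: ifP; rewrite ?normr0 ?normr1. Qed.

Lemma Mat0_row0 q C0 rho (i l : 'I_(1 + (2 + q))) : i = 0%N :> nat ->
  Mat0 q C0 rho i l = if l == 1%N :> nat then rho ^+ 2 else
                      if l == 2%N :> nat then rho else 0.
Proof.
move=> i0; rewrite /Mat0 mxE; case: splitP => [i' ii'|i' ii']; last by rewrite i0 in ii'.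
rewrite mxE; case: splitP => [l' ->|l' ->]; first by rewrite mxE !ord1.
rewrite mxE; case: splitP => [m ->|m ->]; last by rewrite mxE.
have -> : rhorow rho i' m = if m == 0%N :> nat then rho ^+ 2 else rho.
  rewrite /rhorow mxE; case: splitP => m' /= ->; rewrite !mxE !ord1 eqxx mulr1n //.
by case: m => [[|[|m]]].
Qed.

Lemma Mat0_rows q C0 rho rho' (i l : 'I_(1 + (2 + q))) : i != 0%N :> nat ->
  Mat0 q C0 rho i l = Mat0 q C0 rho' i l.
Proof.
move=> i0; rewrite /Mat0 !mxE; case: splitP => // i' ii'.
by rewrite ii' ord1 in i0.
Qed.

Section Describe.
Variable r : nat.

Definition flat (M : 'M[rat]_r.+1) : seq algdesc :=
  [seq descr (M (inord (t %/ r.+1)) (inord (t %% r.+1))) | t <- iota 0 (r.+1 * r.+1)].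

Lemma size_flat M : size (flat M) = (r.+1 * r.+1)%N.
Proof. by rewrite size_map size_iota. Qed.

Lemma flat_lt (i l : 'I_r.+1) : (i * r.+1 + l < r.+1 * r.+1)%N.
Proof.
apply: (@leq_trans (i.+1 * r.+1)); first by rewrite mulSn addnC ltn_add2r.
by rewrite leq_mul2r ltn_ord orbT.
Qed.

Lemma nth_flat M (i l : 'I_r.+1) : nth d0 (flat M) (i * r.+1 + l) = descr (M i l).
Proof.
rewrite (nth_map 0%N) ?size_iota ?flat_lt // nth_iota ?flat_lt // add0n.
by rewrite divnMDl // modnMDl divn_small // modn_small // addn0 !inord_val.
Qed.

Definition descr_list (m : nat) (x : 'I_m -> rat) : seq algdesc :=
  [seq descr (x i) | i <- enum 'I_m].

Lemma size_descr_list m x : size (descr_list m x) = m.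
Proof. by rewrite size_map size_enum_ord. Qed.

Lemma nth_descr_list m x (i : 'I_m) : nth d0 (descr_list m x) i = descr (x i).
Proof. by rewrite (nth_map i) ?size_enum_ord // nth_ord_enum. Qed.

End Describe.

Lemma ratr_foldr (R : realType) m (v : 'rV[rat]_m) (w : 'cV[rat]_m) (M : nat -> 'M[rat]_m) ds :
  (map_mx ratr v *m foldr (fun d acc => map_mx ratr (M d) *m acc) (map_mx ratr w) ds) 0 0 =
  ratr ((v *m foldr (fun d acc => M d *m acc) w ds) 0 0) :> R.
Proof.
have -> : foldr (fun d acc => map_mx ratr (M d) *m acc) (map_mx ratr w) ds =
    map_mx (ratr : rat -> R) (foldr (fun d acc => M d *m acc) w ds).
  by elim: ds => //= d ds ->; rewrite map_mxM.
by rewrite -map_mxM mxE.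
Qed.

Lemma rho_sq y : rho y ^+ 2 = (y ^ 2)%:R^-1.
Proof. by rewrite /rho exprVn natrX. Qed.

Section Representation.
Variables (R : realType) (k : nat) (S : {pred R}).
Hypotheses (k1 : (1 < k)%N) (qS : forall q : rat, ratr q \in S).
Variables (q : nat) (C0 : 'M[rat]_(2 + q, 1 + (2 + q))) (M1 : 'M[rat]_(1 + (2 + q))).
Variables (w : 'cV[rat]_(1 + (2 + q))) (v : 'rV[rat]_(1 + (2 + q))).
Local Notation r := (2 + q).+1.

(** Past the first three entries the matrix does not depend on [rho], so the value 0 stands for any
    other. *)
Definition tail0 : seq algdesc := drop 3 (flat (2 + q) (Mat0 q C0 0)).
Definition list_v : seq algdesc := descr_list r (fun i => v 0 i).
Definition list_w : seq algdesc := descr_list r (fun i => w i 0).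
Definition list_M : seq (seq algdesc) := nseq k.-1 (flat (2 + q) M1).
Definition list_M0 (y : nat) : seq algdesc :=
  descr 0 :: descr01 (y ^ 2)%:R^-1 :: descr01 y%:R^-1 :: tail0.

Lemma size_tail0 : (size tail0).+3 = (r * r)%N.
Proof.
rewrite /tail0 size_drop size_flat -addn3 subnK //.
Qed.

Lemma size_list_M0 y : size (list_M0 y) = (r * r)%N.
Proof. by rewrite -size_tail0. Qed.

Lemma denotes_M0 y (i l : 'I_r) : (0 < y)%N ->
  denotes (nth d0 (list_M0 y) (i * r + l)) (ratr (Mat0 q C0 (rho y) i l) : R).
Proof.
move=> y0.
have inv01 n : (0 < n)%N -> 0 <= (n%:R^-1 : rat) <= 1.
  by move=> n0; rewrite invr_ge0 ler0n invf_le1 ?ltr0n // ler1n.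
have tail (t : nat) : nth d0 (list_M0 y) t.+3 = nth d0 (flat (2 + q) (Mat0 q C0 0)) t.+3.
  by rewrite /list_M0 /= nth_drop.
have [i0|i0] := eqVneq (i : nat) 0%N; last first.
  (* Outside row 0 the position is at least the row length, which is at least 3. *)
  have : (2 < i * r + l)%N by rewrite (leq_trans _ (leq_addr _ _)) // (leq_trans _ (leq_pmull _ _)) ?lt0n.
  move E : (i * r + l)%N => t; case: t E => [|[|[|t]]] // E _.
  by rewrite tail -E nth_flat (Mat0_rows _ _ 0 (rho y)) //; apply: denotes_descr.
rewrite Mat0_row0 // i0 mul0n add0n.
case El : (nat_of_ord l) => [|[|[|t]]] /=.
- exact: denotes_descr.
- by rewrite rho_sq; apply/denotes_descr01/inv01; rewrite expn_gt0 y0.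
- by apply/denotes_descr01/inv01.
- have := nth_flat (2 + q) (Mat0 q C0 0) i l; rewrite i0 mul0n add0n El -tail /= => ->.
  by rewrite Mat0_row0 // El /=; apply: denotes_descr.
Qed.

Lemma represents_pickle y : (0 < y)%N ->
  represents k S
    (pickle ((r, list_v, list_w, list_M0 y :: list_M) : lrep_code))
    (fun n => ratr ((v *m foldr (fun d acc =>
       (if d == 0%N then Mat0 q C0 (rho y) else M1) *m acc) w (digits k n)) 0 0)).
Proof.
move=> y0.
have listMS j : nth [::] (list_M0 y :: list_M) j.+1 = nth [::] (nseq k.-1 (flat (2 + q) M1)) j.
  by [].
exists r, list_v, list_w, (list_M0 y :: list_M), (map_mx ratr v), (map_mx ratr w),
  (fun d => map_mx ratr (if d == 0%N then Mat0 q C0 (rho y) else M1)).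
split.
  split; rewrite ?size_descr_list //.
  - exact: pickleK.
  - by rewrite /= size_nseq prednK // ltnW.
  - move=> [|j] jk; first by rewrite [nth _ _ _]/(list_M0 y) size_list_M0.
    by rewrite listMS nth_nseq -ltnS prednK ?(ltnW k1) // jk size_flat.
split=> [i|i|j jk i l|n]; last by rewrite ratr_foldr.
- by rewrite mxE nth_descr_list; split; [exact: denotes_descr | exact: qS].
- by rewrite mxE nth_descr_list; split; [exact: denotes_descr | exact: qS].
- rewrite mxE; split; last exact: qS.
  case: j jk => [|j] jk; first exact: denotes_M0.
  rewrite listMS nth_nseq -ltnS prednK ?(ltnW k1) // jk nth_flat.
  exact: denotes_descr.
Qed.

End Representation.

Theorem theorem3p10 (R : realType) (k : nat) (S : {pred R}) :
  (2 <= k)%N ->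
  (forall q : rat, ratr q \in S) ->
  (forall x y, x \in S -> y \in S -> x + y \in S) ->
  (forall x, x \in S -> - x \in S) ->
  (forall x y, x \in S -> y \in S -> x * y \in S) ->
  (forall x, x \in S -> algebraic x) ->
  ~ (exists prog : seq instr, decides_poly_growth k S prog).
Proof.
move=> k2 qS _ _ _ _ [D dec].
pose ch := chain kneg kzero kone kdescr0; pose ls := lets D ch outf.
have okc : all okst ch by exact: chain_ok.
have ls_gt0 : (0 < size ls)%N by [].
have [n /andP[n3 bls]] := bdl_ex ls.
have [B /andP[B1 lB]] := light_ex ls.
have X00 u : all (mem ls) u -> sem Xinit u 0%N = 1 by exact: sem_const.
have [q [C0 [M1 [w [v rep]]]]] :=
  representation n ls Xinit (delta B) kappa ls_gt0 n3 bls X00.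
have cE := pickle_lrep (2 + q).+1 (list_v q v) (list_w q w) (tail0 q C0) (list_M k q M1).
move: cE; cbv zeta; set A := pickle (_, list_v q v, _); set T := pickle (tail0 _ _).
(* The self-reference closes here: the exponents of [y] code the parts of the representation chosen
   so far. Reintroducing [A], [T], [U] drops their bodies, so these huge numbers stay abstract. *)
set U := pickle (list_M _ _ _); move: A T U => A T U; set y := yv A T U.
have y0 : (0 < y)%N by exact: yv_gt0.
have repf := represents_pickle R k S k2 qS q C0 M1 w v y y0.
move: repf; set f := (fun n : nat => ratr _); set c := pickle _ => repf.
rewrite -(cval_chain kneg) -/ch => cE.
have fE m : f m = ratr (absr ls Xinit (delta B) kappa (rho y) (digits k m)).1.2.
  by rewrite /f rep mxE eqxx mulr1n.
have acc_halts u : all (mem ls) u -> accepting Xinit y u -> halts_with D c 0.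
  move=> ul [p0 s3 s1].
  have [A' [T' [U' [yE]]]] := reach_sound D ch outf okc outf_ok _ (pen0_reach _ _ _ ul p0) s1.
  (* Acceptance forces the guessed number to be [y], hence the guesses to be [A], [T], [U], and the
     simulated input to be [c] itself. *)
  have [] : [/\ A = A', T = T' & U = U'] by apply: yv_inj; move: yE; rewrite s3 => -[].
  by move=> <- <- <-; rewrite cE.
have halts_acc : halts_with D c 0 -> exists2 u, all (mem ls) u & accepting Xinit y u.
  rewrite cE => /(reach_complete D ch outf okc outf_ok)[X [rX X1 X3]].
  have [u ul [p0 sX]] := reach_pen0 _ _ _ rX.
  by exists u => //; split; rewrite ?sX.
have [growth_halts no_growth_halts] := dec c f repf.
(* An accepting word would make [D] answer 0 by the simulation and 1 by the growth of [f]. *)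
have not_acc : ~ exists2 u, all (mem ls) u & accepting Xinit y u.
  move=> [u ul au]; have h0 := acc_halts u ul au.
  suff /growth_halts h1 : poly_growth f by have := halts_with_det _ _ _ _ h0 h1.
  have g1 := gval_accepting Xinit B y B1 y0 u au.
  have tl : all (mem ls) [:: nth Ltick ls 0] by apply/andP; split=> //; apply: mem_nth.
  have g0 := gval_gt0 ls Xinit B y B1 lB Xinit_le1 y0 _ tl.
  apply: (exp_growth R f k (size (code_block ls u)) (size ls).+2
    (ratr (gval Xinit (delta B) kappa (rho y) [:: nth Ltick ls 0]))
    (ratr (gval Xinit (delta B) kappa (rho y) u))) => //.
  - by rewrite ltr0q.
  - by rewrite -[ltLHS](rmorph1 (ratr : rat -> R)) ltr_rat.
  move=> m; have [a [aE alt]] : exists a, digits k a = code_power ls u m /\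
      (a < k ^ size (code_power ls u m))%N.
    apply: digits_surj => //.
      by apply: sub_all (power_le1 ls u m) => d /leq_ltn_trans; apply.
    by have := last_power ls u m; case: (code_power ls u m) => //= d ds ->.
  exists a; split.
  - apply: leq_trans (size_digits k a); rewrite aE size_power.
    by rewrite (leq_trans _ (leq_addr _ _)) // leq_pmulr.
  - by rewrite -size_power ltnW.
  - by rewrite fE aE absr_power // rmorphM rmorphXn.
(* Without accepting words [f] is bounded by 1, so [D] must answer 0; but that run yields an
   accepting word. *)
apply: (not_acc); apply: halts_acc; apply: no_growth_halts.
have le1 ds : `|(absr ls Xinit (delta B) kappa (rho y) ds).1.2| <= 1.
  apply: (absr_le1 ls Xinit (delta B) kappa (rho y)) => u ul.
  have g0 := gval_gt0 ls Xinit B y B1 lB Xinit_le1 y0 _ ul.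
  rewrite (gtr0_norm g0); apply: (gval_le1 Xinit B y B1 y0) => au.
  by apply: not_acc; exists u.
apply: bounded_no_growth => m; rewrite fE -ratr_norm -(rmorph1 (ratr : rat -> R)).
by rewrite ler_rat.
Qed.
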